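(* Let $X$ be a finite cell complex with $m$ cells, equipped with filtrations $F_1X\subseteq\cdots\subseteq F_NX$ and $G_1X\subseteq\cdots\subseteq G_NX$ such that $G_NX=X=F_NX$ and $G_kX\subseteq F_kX$ for all $k$. The persistent relative homology algorithm described in the context, which computes the barcode of $H_*(F_1X,G_1X)\to\cdots\to H_*(F_NX,G_NX)$ together with relative cycle representatives, runs in $O(m^3)$ time.
   Context: Chains and filtrations. Fix a field $\mathbb K$; time is counted in arithmetic operations in $\mathbb K$ and elementary comparisons/lookups. $C(X)=\bigoplus_p C_p(X)$ is the total cellular chain space over $\mathbb K$, with basis the cells, and $\partial:C(X)\to C(X)$ is the total boundary operator. Each $F_tX,G_tX$ is a subcomplex; the same symbol also denotes the subspace of $C(X)$ spanned by its cells. For a cell $\sigma$, $b_F(\sigma)=\min\{t:\sigma\in F_tX\}$, and $b_G$ is defined similarly. $Z(F_tX,G_tX)=\{c\in F_tX:\partial c\in G_tX\}$, $B(F_tX,G_tX)=\partial(F_tX)+G_tX$, $H_*(F_tX,G_tX)=Z(F_tX,G_tX)/B(F_tX,G_tX)$. For $c\in C(X)$, $f_{ker}(c)=\min\{t\in\{1,\dots,N\}:c\in Z(F_tX,G_tX)\}$ and $f_{im}(c)=\min\{t\in\{1,\dots,N\}:c\in B(F_tX,G_tX)\}$. U-match. A U-match decomposition of $D\in\mathbb K^{n\times m}$ is a tuple $(T,M,D,S)$ with $TM=DS$, $T$ and $S$ square upper triangular with all diagonal entries $1$, and $M\in\mathbb K^{n\times m}$ having at most one nonzero entry in each row and in each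 column. It is known that a U-match decomposition of any $m\times m$ matrix can be computed in $O(m^3)$ time. Algorithm. (1) Order the cells as $\sigma_1,\dots,\sigma_m$ with $b_F(\sigma_1)\le\cdots\le b_F(\sigma_m)$, and as $\tau_1,\dots,\tau_m$ with $b_G(\tau_1)\le\cdots\le b_G(\tau_m)$. (2) Let $\mathcal D$ be the $m\times m$ matrix with $\partial(\sigma_j)=\sum_i\mathcal D_{ij}\tau_i$. (3) Compute a U-match decomposition $(\mathcal T,M,\mathcal D,\mathcal S)$. Index entries by cells: $\mathcal T_{\tau_i\tau_j}=\mathcal T_{ij}$, $\mathcal S_{\sigma_i\sigma_j}=\mathcal S_{ij}$, $M_{\tau_i\sigma_j}=M_{ij}$; columns indexed by a cell $\alpha$ are identified with chains, $COL_\alpha(\mathcal T)=\sum_\rho\mathcal T_{\rho\alpha}\rho$, $COL_\alpha(\mathcal S)=\sum_\rho\mathcal S_{\rho\alpha}\rho$, $COL_\alpha(M)=\sum_\rho M_{\rho\alpha}\rho$. (4) Order the cells as $\beta_1,\dots,\beta_m$ so that $f_{im}(COL_{\beta_i}(\mathcal T))$ is nondecreasing in $i$, and as $\gamma_1,\dots,\gamma_m$ so that $f_{ker}(COL_{\gamma_i}(\mathcal S))$ is nondecreasing in $i$. The values are obtained by lookup: $f_{ker}(COL_\alpha(\mathcal S))=\max\{b_G(COL_\alpha(M)),b_F(\alpha)\}$ (where $b_G$ of a chain is the maximum of $b_G$ over cells with nonzero coefficient, and $b_G(0)=1$), and $f_{im}(COL_\alpha(\mathcal T))=\min\{b_G(\alpha),b_F(\eta)\}$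 if there is a (unique) cell $\eta$ with $M_{\alpha\eta}\ne0$, and $b_G(\alpha)$ otherwise. (5) Let $\mathcal A_{ij}=\mathcal T_{\tau_i\beta_j}$, $\mathcal B_{ij}=\mathcal S_{\tau_i\gamma_j}$. (6) Compute a U-match decomposition $(\tilde{\mathcal T},\tilde M,\mathcal A^{-1}\mathcal B,\tilde{\mathcal S})$ of $\mathcal A^{-1}\mathcal B$. (7) For each nonzero entry $\tilde M_{ij}$ let $u=\sum_k(\mathcal A\tilde{\mathcal T})_{ki}\tau_k$; its values are obtained by lookup as $f_{im}(u)=f_{im}(COL_{\beta_i}(\mathcal T))$ and $f_{ker}(u)=f_{ker}(COL_{\gamma_j}(\mathcal S))$. If they differ, put $(f_{ker}(u),f_{im}(u),u)$ in the output set. Return the output set. *)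

(* Defs.v *)
From HB Require Import structures.
From mathcomp Require Import all_boot all_order all_algebra.

Set Implicit Arguments.
Unset Strict Implicit.
Unset Printing Implicit Defensive.

Import GRing.Theory.
Local Open Scope ring_scope.

(* A finite cell complex enters only through its cellular chain complex over
   K, with basis the cells: [inc x y] is the coefficient of y in the boundary
   of x.  Subcomplexes are the sets of cells closed under taking the cells of
   the boundary. *)
Record cell_complex (K : fieldType) := CellComplex {
  cell :> finType;
  dim : cell -> nat;
  inc : cell -> cell -> K;
  inc_dim : forall x y, inc x y != 0 -> dim x = (dim y).+1;
  inc_inc : forall x z, \sum_y inc x y * inc y z = 0
}.

Section Chains.
Variables (K : fieldType) (X : cell_complex K).
Local Notation chain := {ffun X -> K^o}.

Definition cell_chain (x : X) : chain := [ffun y => (y == x)%:R].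

Definition boundary_fun (c : chain) : chain :=
  [ffun y => \sum_x c x * inc x y].

Fact boundary_fun_linear : linear boundary_fun.
Proof.
move=> a u v; apply/ffunP=> y; rewrite !ffunE scaler_sumr -big_split /=.
by apply: eq_bigr => x _; rewrite !ffunE mulrDl /GRing.scale /= mulrA.
Qed.

HB.instance Definition _ :=
  GRing.isLinear.Build K chain chain *:%R boundary_fun
    boundary_fun_linear.

Definition boundary : 'End(chain) := linfun boundary_fun.

Definition span_cells (A : {set X}) : {vspace chain} :=
  <<[seq cell_chain x | x in A]>>%VS.

Definition subcomplex (A : {set X}) : Prop :=
  forall x y, x \in A -> inc x y != 0 -> y \in A.

Definition rel_cycles (A B : {set X}) : {vspace chain} :=
  (span_cells A :&: boundary @^-1: span_cells B)%VS.

Definition rel_boundaries (A B : {set X}) : {vspace chain} :=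
  (boundary @: span_cells A + span_cells B)%VS.

(* The stages that matter are [stage 1], ..., [stage N].  A filtration given
   for those indices only extends to all of [nat], by the empty subcomplex
   at 0 and by the whole complex above N. *)
Record filtration (N : nat) := Filtration {
  stage :> nat -> {set X};
  stage_subcomplex : forall t, subcomplex (stage t);
  stage_le : forall s t, (s <= t)%N -> stage s \subset stage t;
  stage_top : stage N = [set: X]
}.

(* The least t in {1, ..., N} such that P t holds; all the predicates to
   which it is applied hold at N. *)
Definition first_time (N : nat) (P : pred nat) : nat :=
  \big[minn/N]_(1 <= t < N.+1 | P t) t.

Definition birth N (F : filtration N) (x : X) : nat :=
  first_time N (fun t => x \in F t).

Definition chain_birth N (G : filtration N) (c : chain) : nat :=
  \big[maxn/1%N]_(x | c x != 0) birth G x.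

Definition f_ker N (F G : filtration N) (c : chain) : nat :=
  first_time N (fun t => c \in rel_cycles (F t) (G t)).

Definition f_im N (F G : filtration N) (c : chain) : nat :=
  first_time N (fun t => c \in rel_boundaries (F t) (G t)).

End Chains.

Section SubspaceQuotient.
Local Open Scope quotient_scope.
Variables (K : fieldType) (V : vectType K) (Z B : {vspace V}).

Definition in_denominator : {pred subvs_of Z} := [pred z | vsval z \in B].

Fact in_denominator_closed : zmod_closed in_denominator.
Proof.
by split=> [|u v]; rewrite !inE ?linear0 ?mem0v ?linearB //; apply: rpredB.
Qed.

HB.instance Definition _ :=
  GRing.isZmodClosed.Build (subvs_of Z) in_denominator in_denominator_closed.

(* Z / B when B <= Z, and Z / (Z :&: B) in general. *)
Definition quot_space : Type := Quotient.quot in_denominator.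
HB.instance Definition _ := GRing.Zmodule.on quot_space.

Definition quot_pi (z : subvs_of Z) : quot_space :=
  \pi_(Quotient.quot in_denominator) z.
Definition quot_repr (x : quot_space) : subvs_of Z :=
  @repr _ (Quotient.quot in_denominator) x.

Lemma quot_reprK : cancel quot_repr quot_pi.
Proof. by move=> x; rewrite /quot_pi /quot_repr reprK. Qed.

Lemma quot_piP (u v : subvs_of Z) :
  reflect (quot_pi u = quot_pi v) (vsval u - vsval v \in B).
Proof.
have -> : (vsval u - vsval v \in B) = (u - v \in in_denominator).
  by rewrite inE linearB.
by rewrite Quotient.idealrBE; apply: eqP.
Qed.

Fact quot_pi_is_zmod_morphism : zmod_morphism quot_pi.
Proof.
by move=> u v; rewrite /quot_pi (raddfB (\pi_(Quotient.quot in_denominator))).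
Qed.

Definition quot_scale (a : K) (x : quot_space) : quot_space :=
  quot_pi (a *: quot_repr x).

Fact quot_scale_pi a u : quot_scale a (quot_pi u) = quot_pi (a *: u).
Proof.
apply/quot_piP; rewrite -linearB -scalerBr linearZ memvZ // linearB.
by apply/quot_piP; rewrite quot_reprK.
Qed.

Fact quot_scaleA a b x : quot_scale a (quot_scale b x) = quot_scale (a * b) x.
Proof. by rewrite -[x]quot_reprK !quot_scale_pi scalerA. Qed.

Fact quot_scale1 : left_id 1 quot_scale.
Proof. by move=> x; rewrite -[x]quot_reprK quot_scale_pi scale1r. Qed.

HB.instance Definition _ :=
  GRing.isZmodMorphism.Build (subvs_of Z) quot_space quot_pi
    quot_pi_is_zmod_morphism.

Fact quot_scaleDr : right_distributive quot_scale +%R.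
Proof.
move=> a x y; rewrite -[x]quot_reprK -[y]quot_reprK -raddfD !quot_scale_pi.
by rewrite scalerDr raddfD.
Qed.

Fact quot_scaleDl x : {morph quot_scale^~ x : a b / a + b}.
Proof.
by move=> a b; rewrite -[x]quot_reprK !quot_scale_pi scalerDl raddfD.
Qed.

HB.instance Definition _ :=
  GRing.Zmodule_isLmodule.Build K quot_space quot_scaleA quot_scale1
    quot_scaleDr quot_scaleDl.

Fact quot_pi_is_scalable : scalable quot_pi.
Proof. by move=> a u; rewrite -quot_scale_pi. Qed.

HB.instance Definition _ :=
  GRing.isScalable.Build K (subvs_of Z) quot_space *:%R quot_pi
    quot_pi_is_scalable.

End SubspaceQuotient.

(* The map Z / B -> Z' / B' sending the class of z to the class of z, well
   defined when Z <= Z' and B <= B'. *)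
Section QuotientMap.
Variables (K : fieldType) (V : vectType K) (Z B Z' B' : {vspace V}).

Definition quot_map (x : quot_space Z B) : quot_space Z' B' :=
  quot_pi B' (vsproj Z' (vsval (quot_repr x))).

Hypotheses (sZ : (Z <= Z')%VS) (sB : (B <= B')%VS).

Lemma quot_map_pi (z : subvs_of Z) :
  quot_map (quot_pi B z) = quot_pi B' (vsproj Z' (vsval z)).
Proof.
apply/quot_piP; rewrite !vsprojK ?(subvP sZ) ?subvsP //.
by apply: (subvP sB); apply/quot_piP; rewrite quot_reprK.
Qed.

Fact quot_map_is_linear : linear quot_map.
Proof.
move=> a x y; rewrite -[x]quot_reprK -[y]quot_reprK -linearP !quot_map_pi.
by rewrite -linearP !linearP.
Qed.

End QuotientMap.

(* Persistence modules indexed by nat; below, only the indices 1, ..., N and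
   the maps between them are ever used. *)
Record persistence_module (K : fieldType) := PersistenceModule {
  pspace :> nat -> lmodType K;
  pmap : forall t, {linear pspace t -> pspace t.+1}
}.

Section Barcode.
Variables (K : fieldType) (bars : seq (nat * nat)).

Definition bar (k : nat) : nat * nat := nth (0, 0)%N bars k.

(* A bar (a, b) stands for the interval {t : a <= t < b}. *)
Definition alive (t k : nat) : bool := ((bar k).1 <= t < (bar k).2)%N.

(* The direct sum of the interval modules of the bars: the space at time t
   is K^(bars alive at t), and the map from t to t + 1 is the identity on the
   coordinates of the bars alive at both times. *)
Definition interval_space (t : nat) : lmodType K :=
  {ffun {k : 'I_(size bars) | alive t k} -> K^o}.

Definition interval_map t (f : interval_space t) : interval_space t.+1 :=
  [ffun k => oapp f 0 (insub (val k))].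

Fact interval_map_is_linear t : linear (@interval_map t).
Proof.
move=> a f g; apply/ffunP=> k; rewrite !ffunE.
by case: insubP => [u _ _|_] /=; rewrite ?ffunE // scaler0 addr0.
Qed.

HB.instance Definition _ t :=
  GRing.isLinear.Build K (interval_space t) (interval_space t.+1) *:%R
    (@interval_map t) (@interval_map_is_linear t).

Definition interval_sum : persistence_module K :=
  PersistenceModule (fun t => @interval_map t : {linear _ -> _}).

Definition generator t (k : {k : 'I_(size bars) | alive t k}) :
    interval_sum t := [ffun l => (l == k)%:R].

(* phi is an isomorphism from the sum of the interval modules of the bars
   onto H, over the times 1, ..., N. *)
Definition interval_decomposition (N : nat) (H : persistence_module K)
    (phi : forall t, {linear interval_sum t -> H t}) : Prop :=
  (forall t, (1 <= t <= N)%N -> bijective (phi t)) /\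
  (forall t, (1 <= t < N)%N -> forall f : interval_sum t,
     pmap H t (phi t f) = phi t.+1 (pmap interval_sum t f)).

End Barcode.

Section RelativeHomology.
Variables (K : fieldType) (X : cell_complex K).
Local Notation chain := {ffun X -> K^o}.

Lemma span_cellsS (A A' : {set X}) :
  A \subset A' -> (span_cells A <= span_cells A')%VS.
Proof.
move=> /subsetP sA; apply: sub_span => c /imageP[x Ax ->].
by apply: image_f; apply: sA.
Qed.

Lemma rel_cyclesS (A A' B B' : {set X}) :
  A \subset A' -> B \subset B' -> (rel_cycles A B <= rel_cycles A' B')%VS.
Proof.
by move=> sA sB; rewrite capvS ?span_cellsS // lpreimS ?span_cellsS.
Qed.

Lemma rel_boundariesS (A A' B B' : {set X}) :
  A \subset A' -> B \subset B' ->
  (rel_boundaries A B <= rel_boundaries A' B')%VS.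
Proof. by move=> sA sB; rewrite addvS ?limgS ?span_cellsS. Qed.

Variables (N : nat) (F G : filtration X N).

Local Notation Z t := (rel_cycles (F t) (G t)).
Local Notation B t := (rel_boundaries (F t) (G t)).

Definition rel_homology_map t : quot_space (Z t) (B t) ->
    quot_space (Z t.+1) (B t.+1) := @quot_map _ _ _ _ _ _.

Fact rel_homology_map_is_linear t : linear (@rel_homology_map t).
Proof.
by apply: quot_map_is_linear; rewrite ?rel_cyclesS ?rel_boundariesS ?stage_le.
Qed.

HB.instance Definition _ t :=
  GRing.isLinear.Build K (quot_space (Z t) (B t))
    (quot_space (Z t.+1) (B t.+1)) *:%R (@rel_homology_map t)
    (@rel_homology_map_is_linear t).

(* H(F_1 X, G_1 X) -> ... -> H(F_N X, G_N X), where H is the total homology,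
   the direct sum of the H_p over all p. *)
Definition rel_homology : persistence_module K :=
  @PersistenceModule K (fun t => quot_space (Z t) (B t) : lmodType K)
    (fun t => @rel_homology_map t : {linear _ -> _}).

(* The class in H(F_t X, G_t X) of a relative cycle c. *)
Definition rel_class t (c : chain) : rel_homology t :=
  quot_pi (B t) (vsproj (Z t) c).

(* The bars (a, b) of the triples (a, b, u) in [out] form the barcode of the
   relative homology, through a decomposition into interval modules in which
   the bar (a, b) is generated by the class of the relative cycle u. *)
Definition barcode_with_representatives (out : seq (nat * nat * chain)) :
    Prop :=
  let bars := [seq x.1 | x <- out] in
  [/\ {in bars, forall I : nat * nat, (1 <= I.1 < I.2 <= N)%N},
      {in out, forall x : nat * nat * chain, x.2 \in Z x.1.1} &
      exists2 phi : forall t, {linear interval_sum K bars t -> rel_homology t},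
        interval_decomposition N phi &
        forall t (k : {k : 'I_(size bars) | alive bars t k}), (1 <= t <= N)%N ->
          phi t (generator K k) =
          rel_class t (nth (0%N, 0%N, 0) out (val (val k))).2].

End RelativeHomology.

Record listing (T : Type) (m : nat) := Listing {
  item :> 'I_m -> T;
  rank : T -> 'I_m;
  itemK : cancel item rank;
  rankK : cancel rank item
}.

Definition sorted_by T m (key : T -> nat) (s : listing T m) : Prop :=
  forall i j : 'I_m, (i <= j)%N -> (key (s i) <= key (s j))%N.

Section UMatch.
Variable K : fieldType.

Definition upper_unitriangular n (A : 'M[K]_n) : Prop :=
  (forall i, A i i = 1) /\ (forall i j : 'I_n, (j < i)%N -> A i j = 0).

Definition matching n m (M : 'M[K]_(n, m)) : Prop :=
  (forall i j j', M i j != 0 -> M i j' != 0 -> j = j') /\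
  (forall i i' j, M i j != 0 -> M i' j != 0 -> i = i').

Definition umatch n m (T : 'M[K]_n) (M D : 'M[K]_(n, m)) (S : 'M[K]_m) :
    Prop :=
  [/\ T *m M = D *m S, upper_unitriangular T, upper_unitriangular S &
      matching M].

End UMatch.

Section Algorithm.
Variables (K : fieldType) (X : cell_complex K) (N m : nat).
Variables (F G : filtration X N).
Local Notation chain := {ffun X -> K^o}.

(* The column indexed by the cell [a] of a matrix whose rows and columns are
   indexed by the cells in the orders [r] and [c]. *)
Definition col_chain (r c : listing X m) (A : 'M[K]_m) (a : X) : chain :=
  \sum_(x : X) A (rank r x) (rank c a) *: cell_chain x.

Record trace := Trace {
  sigma : listing X m;
  tau : listing X m;
  matD : 'M[K]_m;
  matT : 'M[K]_m;
  matM : 'M[K]_m;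
  matS : 'M[K]_m;
  beta : listing X m;
  gamma : listing X m;
  matA : 'M[K]_m;
  matB : 'M[K]_m;
  matT' : 'M[K]_m;
  matM' : 'M[K]_m;
  matS' : 'M[K]_m;
  output : seq (nat * nat * chain)
}.

Variable r : trace.

Definition col_T : X -> chain := col_chain (tau r) (tau r) (matT r).
Definition col_S : X -> chain := col_chain (sigma r) (sigma r) (matS r).
Definition col_M : X -> chain := col_chain (tau r) (sigma r) (matM r).

Definition lookup_ker (a : X) : nat :=
  maxn (chain_birth G (col_M a)) (birth F a).

Definition lookup_im (a : X) : nat :=
  if [pick e | matM r (rank (tau r) a) (rank (sigma r) e) != 0] is Some e
  then minn (birth G a) (birth F e) else birth G a.

Definition representative (i : 'I_m) : chain :=
  \sum_(k < m) (matA r *m matT' r) k i *: cell_chain (tau r k).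

(* Any choice is allowed of the order of cells with equal keys, of the two
   U-match decompositions and of the order in which the output is listed. *)
Record is_run : Prop := IsRun {
  run_sigma : sorted_by (birth F) (sigma r);
  run_tau : sorted_by (birth G) (tau r);
  run_D : forall j, boundary X (cell_chain (sigma r j)) =
                    \sum_i matD r i j *: cell_chain (tau r i);
  run_umatch : umatch (matT r) (matM r) (matD r) (matS r);
  run_beta : sorted_by lookup_im (beta r);
  run_gamma : sorted_by lookup_ker (gamma r);
  run_A : forall i j,
    matA r i j = matT r (rank (tau r) (tau r i)) (rank (tau r) (beta r j));
  run_B : forall i j,
    matB r i j =
    matS r (rank (sigma r) (tau r i)) (rank (sigma r) (gamma r j));
  run_umatch' :
    umatch (matT' r) (matM' r) (invmx (matA r) *m matB r) (matS' r);
  run_output_uniq : uniq (output r);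
  run_output : forall x : nat * nat * chain,
    x \in output r <->
    exists i j, [/\ matM' r i j != 0,
      lookup_ker (gamma r j) != lookup_im (beta r i) &
      x = (lookup_ker (gamma r j), lookup_im (beta r i), representative i)]
}.

Record correct : Prop := Correct {
  correct_lookup_ker : forall a, lookup_ker a = f_ker F G (col_S a);
  correct_lookup_im : forall a, lookup_im a = f_im F G (col_T a);
  correct_output : {in output r, forall x : nat * nat * chain,
    x.1 = (f_ker F G x.2, f_im F G x.2)};
  correct_barcode : barcode_with_representatives F G (output r)
}.

End Algorithm.

(* A unit-cost random access machine over K, programmed in a language of
   bounded loops.  Its memory consists of arrays of natural numbers (indices
   and filtration values) and of two-dimensional arrays of field elements;
   entry 0 of an array of naturals doubles as a scalar variable. *)

Inductive iexp : Type :=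
| ICst of nat
| IGet of nat & iexp
| IAdd of iexp & iexp
| ISub of iexp & iexp.

Inductive kexp : Type :=
| KZero
| KOne
| KGet of nat & iexp & iexp
| KAdd of kexp & kexp
| KSub of kexp & kexp
| KMul of kexp & kexp
| KDiv of kexp & kexp.

Inductive test : Type :=
| TLeq of iexp & iexp
| TEqn of iexp & iexp
| TIsZero of kexp.

(* [For x e c] runs c with x = 0, ..., n - 1, where n is the value of e on
   entry. *)
Inductive program : Type :=
| Skip
| ISet of nat & iexp & iexp
| KSet of nat & iexp & iexp & kexp
| Seq of program & program
| If of test & program & program
| For of nat & iexp & program.

Record memory (K : fieldType) := Memory {
  nats : nat -> nat -> nat;
  elts : nat -> nat -> nat -> K
}.

Section Semantics.
Variable K : fieldType.
Implicit Type s : memory K.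

Definition set_nat s (x i v : nat) : memory K :=
  Memory (fun y j => if (y == x) && (j == i) then v else nats s y j) (elts s).

Definition set_elt s (x i j : nat) (v : K) : memory K :=
  Memory (nats s) (fun y k l =>
    if [&& y == x, k == i & l == j] then v else elts s y k l).

Fixpoint ival s (e : iexp) : nat :=
  match e with
  | ICst n => n
  | IGet x e1 => nats s x (ival s e1)
  | IAdd e1 e2 => (ival s e1 + ival s e2)%N
  | ISub e1 e2 => (ival s e1 - ival s e2)%N
  end.

Fixpoint kval s (e : kexp) : K :=
  match e with
  | KZero => 0
  | KOne => 1
  | KGet x e1 e2 => elts s x (ival s e1) (ival s e2)
  | KAdd e1 e2 => kval s e1 + kval s e2
  | KSub e1 e2 => kval s e1 - kval s e2
  | KMul e1 e2 => kval s e1 * kval s e2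
  | KDiv e1 e2 => kval s e1 / kval s e2
  end.

Definition tval s (b : test) : bool :=
  match b with
  | TLeq e1 e2 => (ival s e1 <= ival s e2)%N
  | TEqn e1 e2 => ival s e1 == ival s e2
  | TIsZero e => kval s e == 0
  end.

End Semantics.

(* Every operation, comparison, array access, constant, assignment and loop
   iteration costs one unit. *)

Fixpoint icost (e : iexp) : nat :=
  match e with
  | ICst _ => 1
  | IGet _ e1 => (icost e1).+1
  | IAdd e1 e2 | ISub e1 e2 => (icost e1 + icost e2).+1
  end.

Fixpoint kcost (e : kexp) : nat :=
  match e with
  | KZero | KOne => 1
  | KGet _ e1 e2 => (icost e1 + icost e2).+1
  | KAdd e1 e2 | KSub e1 e2 | KMul e1 e2 | KDiv e1 e2 =>
      (kcost e1 + kcost e2).+1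
  end.

Definition tcost (b : test) : nat :=
  match b with
  | TLeq e1 e2 | TEqn e1 e2 => (icost e1 + icost e2).+1
  | TIsZero e => (kcost e).+1
  end.

Fixpoint exec (K : fieldType) (p : program) (s : memory K) : memory K * nat :=
  match p with
  | Skip => (s, 1)
  | ISet x e1 e2 =>
      (set_nat s x (ival s e1) (ival s e2), (icost e1 + icost e2).+1)
  | KSet x e1 e2 e3 =>
      (set_elt s x (ival s e1) (ival s e2) (kval s e3),
       (icost e1 + icost e2 + kcost e3).+1)
  | Seq p1 p2 =>
      let: (s1, k1) := exec p1 s in
      let: (s2, k2) := exec p2 s1 in (s2, k1 + k2)
  | If b p1 p2 =>
      let: (s1, k1) := exec (if tval s b then p1 else p2) s in
      (s1, (tcost b + k1).+1)
  | For x e p1 =>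
      iteri (ival s e)
        (fun v (sk : memory K * nat) =>
           let: (s1, k1) := exec p1 (set_nat sk.1 x 0 v) in
           (s1, (sk.2 + k1).+1))
        (s, (icost e).+1)
  end%N.

(* Addresses of arrays of naturals; [in_size] and [out_size] are scalars. *)
Definition in_size := 0%N.
Definition in_birthF := 1%N.
Definition in_birthG := 2%N.
Definition out_sigma := 3%N.
Definition out_tau := 4%N.
Definition out_beta := 5%N.
Definition out_gamma := 6%N.
Definition out_size := 7%N.
Definition out_ker := 8%N.
Definition out_im := 9%N.

(* Addresses of arrays of field elements, a separate address space. *)
Definition in_boundary := 0%N.
Definition out_D := 1%N.
Definition out_T := 2%N.
Definition out_M := 3%N.
Definition out_S := 4%N.
Definition out_A := 5%N.
Definition out_B := 6%N.
Definition out_T' := 7%N.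
Definition out_M' := 8%N.
Definition out_S' := 9%N.
Definition out_chain := 10%N.

Section Encoding.
Variables (K : fieldType) (X : cell_complex K) (N m : nat).

(* The listing e numbers the cells of the input; the input consists of the
   number of cells, the birth times of the cells in both filtrations and the
   matrix of the boundary operator. *)
Definition input (F G : filtration X N) (e : listing X m) : memory K :=
  Memory
    (fun x i =>
       if x == in_size then (if i == 0%N then m else 0%N) else
       if insub i is Some j then
         if x == in_birthF then birth F (e j) else
         if x == in_birthG then birth G (e j) else 0%N
       else 0%N)
    (fun x i j =>
       if x != in_boundary then 0 else
       if (insub i, insub j) is (Some k, Some l) then inc (e l) (e k) else 0).

Definition stores_listing (e : listing X m) (s : memory K) (x : nat)
    (c : listing X m) : Prop :=
  forall i : 'I_m, nats s x i = rank e (c i).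

Definition stores_matrix (s : memory K) (x : nat) (A : 'M[K]_m) : Prop :=
  forall i j : 'I_m, elts s x i j = A i j.

Definition stores_output (e : listing X m) (s : memory K)
    (out : seq (nat * nat * {ffun X -> K^o})) : Prop :=
  nats s out_size 0 = size out /\
  forall k, (k < size out)%N ->
    let: (a, b, u) := nth (0%N, 0%N, 0) out k in
    [/\ nats s out_ker k = a, nats s out_im k = b &
        forall i : 'I_m, elts s out_chain k i = u (e i)].

Record stores (e : listing X m) (s : memory K) (r : trace X m) : Prop :=
  Stores {
    stores_sigma : stores_listing e s out_sigma (sigma r);
    stores_tau : stores_listing e s out_tau (tau r);
    stores_D : stores_matrix s out_D (matD r);
    stores_T : stores_matrix s out_T (matT r);
    stores_M : stores_matrix s out_M (matM r);
    stores_S : stores_matrix s out_S (matS r);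
    stores_beta : stores_listing e s out_beta (beta r);
    stores_gamma : stores_listing e s out_gamma (gamma r);
    stores_A : stores_matrix s out_A (matA r);
    stores_B : stores_matrix s out_B (matB r);
    stores_T' : stores_matrix s out_T' (matT' r);
    stores_M' : stores_matrix s out_M' (matM' r);
    stores_S' : stores_matrix s out_S' (matS' r);
    stores_out : stores_output e s (output r)
  }.

End Encoding.

(* Main.v *)
Require Import Defs.
From HB Require Import structures.
From mathcomp Require Import all_boot all_order perm all_algebra zify.

Set Implicit Arguments.
Unset Strict Implicit.
Unset Printing Implicit Defensive.

Import GRing.Theory.
Local Open Scope ring_scope.

(** Correctness.  In the bases given by the columns of S and of T the boundary
    operator is the matching M, since D S = T M.  As S and T are unitriangular
    for orders in which the birth times increase, every stage of F is spanned by
    columns of S and every stage of G by columns of T.  Hence the relative cycles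
    at time t are spanned by the columns of S with f_ker at most t
    ([mem_cyclesE]), and the relative boundaries by the columns of T with f_im at
    most t ([mem_boundariesE]).  The second U-match decomposition reads
    A T' M' = B S': up to order and scaling, the columns of A T' and of B S' are
    the same.  The matrices T' and S' are unitriangular for the orders in which
    f_im and f_ker increase, so that these columns form one basis adapted to the
    cycles and to the boundaries at all times ([mem_cycles_coords],
    [mem_boundaries_coords]).  The homology at time t therefore has as basis the
    classes of the columns u such that f_ker u <= t < f_im u, and the maps of the
    persistence module send a class of this basis to the class of the same chain;
    this is the decomposition into interval modules ([class_map_bij],
    [class_map_natural]).

    Running time.  A program all of whose loops range over the m cells and are
    nested at most three deep takes O(m^3) time ([exec_cost]), so that it suffices
    to write one of this form.  The cells are sorted by counting predecessors.  A
    U-match decomposition is computed by clearing the rows of the matrix from the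
    last one up with column operations ([eliminated_pivot]).  Since A is T with
    its columns permuted, A^-1 B is obtained by solving T Y = B and permuting the
    rows of Y.  Every phase of the program computes one part of the trace, which
    is then read off the final memory ([algorithm_run]). *)

(** * Birth times *)

Section FirstTime.
Local Open Scope nat_scope.

Lemma bigmin_leq (P : pred nat) N r t :
  t \in r -> P t -> \big[minn/N]_(s <- r | P s) s <= t.
Proof.
elim: r => // a r IH; rewrite inE big_cons => /predU1P[<- -> | rt Pt].
  exact: geq_minl.
by case: ifP => _; [apply: leq_trans (geq_minr _ _) _|]; apply: IH.
Qed.

Lemma leq_bigmaxP (T : Type) (P : pred T) (f : T -> nat) a t (r : seq T) :
  (\big[maxn/a]_(x <- r | P x) f x <= t) =
  (a <= t) && all (fun x => P x ==> (f x <= t)) r.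
Proof.
elim: r => [|x r IH]; first by rewrite big_nil andbT.
rewrite big_cons /=; case: (P x) => //=.
by rewrite geq_max IH andbCA.
Qed.

Lemma first_time_eq N (P : pred nat) v : 1 <= v <= N ->
  (forall t, 1 <= t <= N -> P t = (v <= t)) -> first_time N P = v.
Proof.
move=> vN PE; apply/eqP; rewrite eqn_leq /first_time; apply/andP; split.
  by apply: bigmin_leq; rewrite ?mem_index_iota ?PE.
rewrite big_nat_cond; apply: (big_ind (fun n => v <= n)).
- by case/andP: vN.
- by move=> x y vx vy; rewrite leq_min vx.
- by move=> t /andP[tN Pt]; rewrite -PE.
Qed.

Lemma first_time_range N P : 1 <= N -> 1 <= first_time N P <= N.
Proof.
move=> N1; rewrite /first_time big_nat_cond.
apply: (big_ind (fun n => 1 <= n <= N)); first by rewrite N1 leqnn.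
  move=> x y /andP[x1 xN] /andP[y1 yN].
  by rewrite leq_min x1 y1 geq_min xN.
by move=> t /andP[].
Qed.

End FirstTime.

Section Births.
Variables (K : fieldType) (X : cell_complex K) (N : nat).
Hypothesis N1 : (1 <= N)%N.
Implicit Type F : filtration X N.

Lemma birth_range F x : (1 <= birth F x <= N)%N.
Proof. exact: first_time_range. Qed.

Lemma birth_leq F x t : (1 <= t <= N)%N -> (birth F x <= t)%N = (x \in F t).
Proof.
move=> tN; case/andP: (tN) => t1 _; apply/idP/idP => [bt|xt]; last first.
  by apply: bigmin_leq; rewrite ?mem_index_iota.
have : x \in F (birth F x).
  rewrite /birth /first_time.
  apply: (big_ind (fun n => x \in F n)) => //.
    by rewrite stage_top inE.
  by move=> a b xa xb; rewrite /minn; case: ifP.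
by apply/subsetP/stage_le.
Qed.

Lemma chain_birth_range F c : (1 <= chain_birth F c <= N)%N.
Proof.
apply: (big_ind (fun n => 1 <= n <= N)%N) => //.
  by move=> x y /andP[x1 xN] /andP[y1 yN]; rewrite leq_max x1 geq_max xN.
by move=> x _; apply: birth_range.
Qed.

Lemma chain_birth_leq F (c : {ffun X -> K^o}) t : (1 <= t <= N)%N ->
  (chain_birth F c <= t)%N = [forall x, (c x != 0) ==> (x \in F t)].
Proof.
move=> tN; rewrite /chain_birth leq_bigmaxP; case/andP: (tN) => -> _ /=.
apply/allP/forallP => H x.
  by rewrite -birth_leq //; apply: H; rewrite mem_index_enum.
by rewrite birth_leq.
Qed.

End Births.

(** * Chains in coordinates *)

Section Supports.
Variable K : fieldType.

Definition supported n (v : 'cV[K]_n) (P : pred 'I_n) : bool :=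
  [forall i, (v i 0 != 0) ==> P i].

Lemma supportedP n (v : 'cV[K]_n) (P : pred 'I_n) :
  reflect (forall i, v i 0 != 0 -> P i) (supported v P).
Proof. exact: 'forall_implyP. Qed.

Lemma eq_supported n (v : 'cV[K]_n) (P Q : pred 'I_n) :
  P =1 Q -> supported v P = supported v Q.
Proof. by move=> PQ; apply: eq_forallb => i; rewrite PQ. Qed.

Lemma supported_delta n (i : 'I_n) (P : pred 'I_n) :
  supported (delta_mx i 0 : 'cV[K]_n) P = P i.
Proof.
apply/supportedP/idP => [|Pi j]; first by apply; rewrite !mxE !eqxx oner_eq0.
by rewrite mxE andbT; case: (j =P i) => [->|] //; rewrite eqxx.
Qed.

Lemma mulmx_neq0 n p (A : 'M[K]_(n, p)) (v : 'cV[K]_p) i :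
  (A *m v) i 0 != 0 -> exists2 j, A i j != 0 & v j 0 != 0.
Proof.
move=> Avi; case: (pickP (fun j => (A i j != 0) && (v j 0 != 0))).
  by move=> j /andP[]; exists j.
move=> H; case/eqP: Avi; rewrite mxE big1 // => j _; apply/eqP.
by rewrite mulf_eq0; move/(_ j)/negbT: H; rewrite negb_and !negbK.
Qed.

(** A unitriangular matrix preserves every initial coordinate subspace, and
    so does its inverse: the last coordinate of v outside P would survive. *)
Lemma supported_unitriangular n (S : 'M[K]_n) (v : 'cV[K]_n) (P : pred 'I_n) :
  upper_unitriangular S ->
  (forall i j : 'I_n, (i <= j)%N -> P j -> P i) ->
  supported (S *m v) P = supported v P.
Proof.
move=> [S1 S0] Pdown; apply/supportedP/supportedP => H i; last first.
  case/mulmx_neq0 => j Sij vj; apply: (Pdown _ j); last exact: H.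
  by rewrite leqNgt; apply: contraNN Sij => ji; rewrite S0.
move=> vi; apply: contraT => Pi.
pose bad (j : 'I_n) := (v j 0 != 0) && ~~ P j.
have bi : bad i by rewrite /bad vi.
case: (@arg_maxnP _ i bad (fun j => val j) bi) => j /andP[vj Pj] jmax.
case/negP: (Pj); apply: H; rewrite mxE (bigD1 j) //= S1 mul1r big1 ?addr0 //.
move=> k kj; case: (ltngtP k j) => [lkj|ljk|/val_inj ekj].
- by rewrite S0 ?mul0r.
- suff /eqP-> : v k 0 == 0 by rewrite mulr0.
  apply: contraT => vk; case: (boolP (P k)) => Pk.
    by case/negP: Pj; apply: Pdown Pk; apply: ltnW.
  by have := jmax k; rewrite /bad vk Pk => /(_ isT); rewrite /= leqNgt ljk.
- by rewrite ekj eqxx in kj.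
Qed.

Lemma unitriangular_unit n (S : 'M[K]_n) :
  upper_unitriangular S -> S \in unitmx.
Proof.
move=> [S1 S0]; rewrite -unitmx_tr unitmxE det_trig; last first.
  by apply/is_trig_mxP => i j ij; rewrite mxE S0.
by rewrite big1 ?unitr1 // => i _; rewrite mxE.
Qed.

End Supports.

Section Coordinates.
Variables (K : fieldType) (X : cell_complex K) (m : nat).
Local Notation chain := {ffun X -> K^o}.
Implicit Types (r : listing X m) (c : chain).

Definition vec r c : 'cV[K]_m := \col_i c (r i).
Definition unvec r (v : 'cV[K]_m) : chain := [ffun x => v (rank r x) 0].

Lemma vecK r : cancel (vec r) (unvec r).
Proof. by move=> c; apply/ffunP => x; rewrite ffunE mxE rankK. Qed.

Lemma unvecK r : cancel (unvec r) (vec r).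
Proof. by move=> v; apply/colP => i; rewrite mxE ffunE itemK. Qed.

Fact vec_is_linear r : linear (vec r).
Proof. by move=> a c d; apply/colP => i; rewrite !mxE !ffunE. Qed.
HB.instance Definition _ r :=
  GRing.isLinear.Build K chain 'cV[K]_m *:%R (vec r) (vec_is_linear r).

Lemma rank_inj r : injective (rank r).
Proof. exact: can_inj (@rankK _ _ r). Qed.

Lemma item_bij r : bijective r.
Proof. by exists (rank r); [apply: itemK | apply: rankK]. Qed.

Lemma rank_bij r : bijective (rank r).
Proof. by exists r; [apply: rankK | apply: itemK]. Qed.

Lemma sum_cell_chain (a : X -> K) x :
  (\sum_y a y *: cell_chain y : chain) x = a x.
Proof.
rewrite sum_ffunE (bigD1 x) //= big1 => [|y yx].
  by rewrite !ffunE eqxx addr0; apply: mulr1.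
by rewrite !ffunE eq_sym (negPf yx) scaler0.
Qed.

Lemma sum_item_chain r (a : 'I_m -> K) x :
  (\sum_i a i *: cell_chain (r i) : chain) x = a (rank r x).
Proof.
rewrite sum_ffunE (bigD1 (rank r x)) //= big1 => [|i ix].
  by rewrite !ffunE rankK eqxx addr0; apply: mulr1.
rewrite !ffunE; case: eqP => [e|_]; last by rewrite scaler0.
by rewrite e itemK eqxx in ix.
Qed.

Lemma mem_span_cells (A : {set X}) c :
  (c \in span_cells A) = [forall x, (c x != 0) ==> (x \in A)].
Proof.
apply/idP/'forall_implyP => [cA x|H].
  apply: contraNT => xA; move: (cA) => /coord_span->.
  rewrite sum_ffunE big1 // => i _; rewrite ffunE.
  have : [seq cell_chain x | x in A]`_i \in [seq cell_chain x | x in A].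
    by rewrite mem_nth ?size_tuple // -[X in (_ < X)%N](size_tuple (in_tuple _)).
  case/imageP => y yA ->; rewrite ffunE.
  case: eqP => [exy|]; last by rewrite scaler0.
  by rewrite exy yA in xA.
have -> : c = \sum_(y in A) c y *: cell_chain y.
  apply/ffunP => x; rewrite -[in LHS](sum_cell_chain c x) !sum_ffunE.
  rewrite [RHS]big_mkcond /=; apply: eq_bigr => y _.
  case: ifP => // /negbT yA; suff /eqP-> : c y == 0 by rewrite scale0r ffunE.
  by apply: contraNT yA; apply: H.
by apply: memv_suml => y yA; apply: memvZ; apply/memv_span/image_f.
Qed.

Lemma mem_span_supported r (A : {set X}) c :
  (c \in span_cells A) = supported (vec r c) (fun i => r i \in A).
Proof.
rewrite mem_span_cells; apply/'forall_implyP/supportedP => H.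
  by move=> i; rewrite mxE; apply: H.
by move=> x; have := H (rank r x); rewrite mxE rankK.
Qed.

Lemma mem_rel_cycles (A B : {set X}) c :
  (c \in rel_cycles A B) =
  (c \in span_cells A) && (boundary X c \in span_cells B).
Proof. by rewrite /rel_cycles memv_cap -memv_preim. Qed.

Lemma mem_rel_boundaries (A B : {set X}) c :
  reflect (exists b g, [/\ b \in span_cells A, g \in span_cells B &
                          c = boundary X b + g])
          (c \in rel_boundaries A B).
Proof.
apply: (iffP memv_addP) => [[x /memv_imgP[b bA ->] [g gB ->]]|[b [g [bA gB ->]]]].
  by exists b, g.
by exists (boundary X b); [apply: memv_img | exists g].
Qed.

Lemma boundaryE c y : boundary X c y = \sum_x c x * inc x y.
Proof. by rewrite lfunE /= ffunE. Qed.

Lemma boundary_cell x y : boundary X (cell_chain x) y = inc x y.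
Proof.
rewrite boundaryE (bigD1 x) //= big1 => [|z zx].
  by rewrite ffunE eqxx mul1r addr0.
by rewrite ffunE (negPf zx) mul0r.
Qed.

End Coordinates.

(** * Bases adapted to both filtrations *)

Section Representatives.
Variables (K : fieldType) (X : cell_complex K) (m : nat) (r : trace X m).

Lemma vec_representative i :
  vec (tau r) (representative r i) = (matA r *m matT' r) *m delta_mx i 0.
Proof.
by apply/colP => k; rewrite -colE !mxE /representative sum_item_chain itemK mxE.
Qed.

Lemma representative_inj :
  matA r *m matT' r \in unitmx -> injective (representative r).
Proof.
move=> u i j e; have := vec_representative i; rewrite e vec_representative.
move=> /(congr1 (mulmx (invmx (matA r *m matT' r)))); rewrite !mulKmx //.
move/colP/(_ j); rewrite !mxE eqxx /= andbT.
by case: eqP => // _ /eqP; rewrite oner_eq0.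
Qed.

Lemma perm_cols_unit (A B : 'M[K]_m) (f g : 'I_m -> 'I_m) :
  injective f -> injective g -> (forall i j, A i j = B (f i) (g j)) ->
  B \in unitmx -> A \in unitmx.
Proof.
move=> injf injg AB uB.
have -> : A = row_perm (perm injf) (col_perm (perm injg) B).
  by apply/matrixP => i j; rewrite !mxE !permE.
by rewrite row_permE col_permE !unitmx_mul !unitmx_perm uB.
Qed.

End Representatives.

Section AdaptedBases.
Variables (K : fieldType) (X : cell_complex K) (N m : nat).
Variables (F G : filtration X N) (r : trace X m).
Hypotheses (N1 : (1 <= N)%N) (run : is_run F G r).
Local Notation chain := {ffun X -> K^o}.
Local Notation T := (matT r).
Local Notation M := (matM r).
Local Notation S := (matS r).
Local Notation lker := (lookup_ker F G r).
Local Notation lim := (lookup_im F G r).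
Local Notation sig := (sigma r).
Local Notation ta := (tau r).
Local Notation be := (beta r).
Local Notation ga := (gamma r).

Lemma umatch_row (i j j' : 'I_m) : M i j != 0 -> j' != j -> M i j' = 0.
Proof.
case: (run_umatch run) => _ _ _ [Mrow _] Mij; apply: contraNeq => Mij'.
exact/eqP/(Mrow _ _ _ Mij' Mij).
Qed.

Lemma lookup_ker_leq t j : (1 <= t <= N)%N ->
  (lker (sig j) <= t)%N =
  (sig j \in F t) && [forall i, (M i j != 0) ==> (ta i \in G t)].
Proof.
move=> tN; rewrite /lookup_ker geq_max chain_birth_leq // birth_leq //.
rewrite andbC; congr (_ && _); rewrite /col_M /col_chain.
apply/'forall_implyP/'forall_implyP => H i; have := H.
  by move/(_ (ta i)); rewrite sum_cell_chain !itemK.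
by move/(_ (rank ta i)); rewrite sum_cell_chain itemK rankK.
Qed.

Lemma lookup_im_leq t i : (1 <= t <= N)%N ->
  (lim (ta i) <= t)%N =
  (ta i \in G t) || [exists j, (M i j != 0) && (sig j \in F t)].
Proof.
move=> tN; rewrite /lookup_im itemK; case: pickP => [x Mx|M0].
  rewrite geq_min !birth_leq //; congr (_ || _).
  apply/idP/existsP => [xF|[j /andP[Mj jF]]].
    by exists (rank sig x); rewrite Mx rankK.
  case: (run_umatch run) => _ _ _ [Mrow _].
  by rewrite -[x](rankK sig) (Mrow _ _ _ Mx Mj).
rewrite birth_leq //; case: existsP; last by rewrite orbF.
by case=> j /andP[Mj _]; have := M0 (sig j); rewrite itemK Mj.
Qed.

Lemma vec_boundary c : vec ta (boundary X c) = matD r *m vec sig c.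
Proof.
have -> : c = \sum_j vec sig c j 0 *: cell_chain (sig j).
  by apply/ffunP => x; rewrite sum_item_chain mxE rankK.
rewrite !linear_sum; apply: eq_bigr => j _; rewrite !linearZ /=.
congr (_ *: _); rewrite (run_D run); apply/colP => i.
rewrite !mxE sum_item_chain itemK (bigD1 j) //= big1 => [|l lj].
  by rewrite !mxE !ffunE eqxx addr0 mulr1.
by rewrite !mxE !ffunE (can_eq (@itemK _ _ sig)) (negPf lj) mulr0.
Qed.

Lemma F_initial t (i j : 'I_m) : (1 <= t <= N)%N ->
  (i <= j)%N -> sig j \in F t -> sig i \in F t.
Proof.
by move=> tN ij; rewrite -!(birth_leq _ _ tN); apply/leq_trans/(run_sigma run).
Qed.

Lemma G_initial t (i j : 'I_m) : (1 <= t <= N)%N ->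
  (i <= j)%N -> ta j \in G t -> ta i \in G t.
Proof.
by move=> tN ij; rewrite -!(birth_leq _ _ tN); apply/leq_trans/(run_tau run).
Qed.

(** Since D S = T M, the boundary of a combination of columns of S is the same
    combination of the matched columns of T.  Both families of columns are
    unitriangular, hence a combination lies in F t, or its boundary in G t, if
    and only if each of its terms does. *)
Lemma mem_cyclesE t c w : (1 <= t <= N)%N -> vec sig c = S *m w ->
  (c \in rel_cycles (F t) (G t)) =
  supported w (fun j => (lker (sig j) <= t)%N).
Proof.
move=> tN cw; case: (run_umatch run) => TM uT uS _.
rewrite mem_rel_cycles (mem_span_supported sig) (mem_span_supported ta).
rewrite vec_boundary cw mulmxA -TM -mulmxA.
rewrite (supported_unitriangular w uS); last by move=> i j; apply: F_initial.
rewrite (supported_unitriangular (M *m w) uT); last first.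
  by move=> i j; apply: G_initial.
rewrite (eq_supported w (fun j => lookup_ker_leq j tN)).
apply/andP/supportedP => [[/supportedP wF /supportedP MwG] j wj|H].
  rewrite wF //=; apply/'forall_implyP => i Mij; apply: MwG.
  rewrite mxE (bigD1 j) //= big1 ?addr0 ?mulf_neq0 // => k kj.
  by rewrite (umatch_row Mij kj) mul0r.
split; apply/supportedP => i; first by move/H/andP=> [].
by case/mulmx_neq0 => j Mij /H /andP[_ /'forall_implyP]; apply.
Qed.

(** A column of T is a relative boundary as soon as it lies in G t or is
    matched to a column of S which lies in F t.  Conversely, D S = T M writes
    every relative boundary as a combination of such columns only. *)
Lemma mem_boundariesE t c w : (1 <= t <= N)%N -> vec ta c = T *m w ->
  (c \in rel_boundaries (F t) (G t)) =
  supported w (fun i => (lim (ta i) <= t)%N).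
Proof.
move=> tN cw; case: (run_umatch run) => TM uT uS [Mrow Mcol].
have unT := unitriangular_unit uT; have unS := unitriangular_unit uS.
rewrite (eq_supported w (fun j => lookup_im_leq j tN)).
have supF v : supported (S *m v) (fun j => sig j \in F t) =
              supported v (fun j => sig j \in F t).
  by apply: supported_unitriangular => // i j; apply: F_initial.
have supG v : supported (T *m v) (fun j => ta j \in G t) =
              supported v (fun j => ta j \in G t).
  by apply: supported_unitriangular => // i j; apply: G_initial.
apply/mem_rel_boundaries/supportedP => [[b [g [bF gG c_eq]]] i wi|H].
  move: bF gG; rewrite (mem_span_supported sig) (mem_span_supported ta).
  rewrite -[vec sig b](mulKVmx unS) -[vec ta g](mulKVmx unT) supF supG.
  set wb := invmx S *m _; set wg := invmx T *m _.
  move=> /supportedP wbF /supportedP wgG.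
  have w_eq : w = M *m wb + wg.
    rewrite -[w](mulKmx unT) -cw c_eq linearD /= vec_boundary.
    rewrite -[vec sig b](mulKVmx unS) mulmxDr -/wg; congr (_ + _).
    by rewrite [matD r *m _]mulmxA -TM -mulmxA mulKmx.
  case: (boolP (ta i \in G t)) => //= iG; apply/existsP.
  have : (M *m wb) i 0 != 0.
    apply: contraNneq wi => Mwb0; rewrite w_eq mxE Mwb0 add0r.
    by apply: contraNT iG; apply: wgG.
  by case/mulmx_neq0 => j Mij wbj; exists j; rewrite Mij wbF.
(* The terms which lie in G t make up the relative part; the others are
   divided by their entry of M and transported to the columns of S. *)
pose wg : 'cV[K]_m := \col_i (if ta i \in G t then w i 0 else 0).
pose wb : 'cV[K]_m := \col_j \sum_(i | (M i j != 0) && (ta i \notin G t))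
  w i 0 / M i j.
exists (unvec sig (S *m wb)), (unvec ta (T *m wg)); split.
- rewrite (mem_span_supported sig) unvecK supF; apply/supportedP => j.
  rewrite mxE; apply: contraR => jF; apply/eqP/big1 => i /andP[Mij iG].
  suff /eqP-> : w i 0 == 0 by rewrite mul0r.
  apply: contraNT jF => /H; rewrite (negPf iG) /= => /existsP[k /andP[Mik kF]].
  by rewrite (Mrow _ _ _ Mij Mik).
- rewrite (mem_span_supported ta) unvecK supG; apply/supportedP => i.
  by rewrite mxE; case: ifP; rewrite ?eqxx.
- apply: (can_inj (vecK ta)); rewrite linearD /= vec_boundary !unvecK cw.
  rewrite mulmxA -TM -mulmxA -mulmxDr; congr (_ *m _); apply/colP => i.
  rewrite !mxE; case: ifPn => iG.
    rewrite big1 ?add0r // => j _; rewrite mxE.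
    case: (eqVneq (M i j) 0) => [->|Mij]; first by rewrite mul0r.
    rewrite big1 ?mulr0 // => k /andP[Mkj].
    by rewrite (Mcol _ _ _ Mkj Mij) iG.
  rewrite addr0; case: (eqVneq (w i 0) 0) => [wi|wi].
    rewrite wi big1 // => j _; rewrite mxE.
    case: (eqVneq (M i j) 0) => [->|Mij]; first by rewrite mul0r.
    rewrite big1 ?mulr0 // => k /andP[Mkj _].
    by rewrite (Mcol _ _ _ Mkj Mij) wi mul0r.
  have := H i wi; rewrite (negPf iG) /= => /existsP[j /andP[Mij _]].
  rewrite (bigD1 j) //= big1 => [|k kj]; last by rewrite (umatch_row Mij kj) mul0r.
  rewrite addr0 mxE (bigD1 i) /= ?Mij // big1 => [|k /andP[/andP[Mkj _] ki]].
    by rewrite addr0 mulrC divfK.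
  by rewrite (Mcol _ _ _ Mkj Mij) eqxx in ki.
Qed.

Lemma lookup_ker_range a : (1 <= lker a <= N)%N.
Proof.
case/andP: (birth_range N1 F a) => bF1 bFN.
case/andP: (chain_birth_range N1 G (col_M r a)) => bG1 bGN.
by rewrite /lookup_ker leq_max bG1 geq_max bGN.
Qed.

Lemma lookup_im_range a : (1 <= lim a <= N)%N.
Proof.
case/andP: (birth_range N1 G a) => bG1 bGN; rewrite /lookup_im.
case: pickP => [x _|_]; last by rewrite bG1.
case/andP: (birth_range N1 F x) => bF1 bFN.
by rewrite leq_min bG1 bF1 geq_min bFN orbT.
Qed.

Lemma vec_col_chain (p q : listing X m) A a :
  vec p (col_chain p q A a) = A *m delta_mx (rank q a) 0.
Proof.
by apply/colP => i; rewrite -colE !mxE /col_chain sum_cell_chain itemK.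
Qed.

Lemma lookup_kerE a : lker a = f_ker F G (col_S r a).
Proof.
apply/esym/first_time_eq; first exact: lookup_ker_range.
move=> t tN; rewrite (mem_cyclesE tN (vec_col_chain _ _ _ _)).
by rewrite supported_delta rankK.
Qed.

Lemma lookup_imE a : lim a = f_im F G (col_T r a).
Proof.
apply/esym/first_time_eq; first exact: lookup_im_range.
move=> t tN; rewrite (mem_boundariesE tN (vec_col_chain _ _ _ _)).
by rewrite supported_delta rankK.
Qed.

(** ** The common basis *)

Definition common : 'M[K]_m := matA r *m matT' r.
Definition coords (c : chain) : 'cV[K]_m := invmx common *m vec ta c.

Fact coords_is_linear : linear coords.
Proof. by move=> a c d; rewrite /coords !linearP. Qed.
HB.instance Definition _ :=
  GRing.isLinear.Build K chain 'cV[K]_m *:%R coords coords_is_linear.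

Lemma matA_mul y : matA r *m y = T *m \col_i y (rank be (ta i)) 0.
Proof.
apply/colP => i; rewrite !mxE.
have bij_h : bijective (rank ta \o be) by apply: bij_comp (rank_bij _) (item_bij _).
rewrite [RHS](reindex (rank ta \o be)) /=; last exact: onW_bij.
by apply: eq_bigr => j _; rewrite mxE rankK itemK (run_A run) itemK.
Qed.

Lemma matB_mul c y : vec ta c = matB r *m y ->
  vec sig c = S *m \col_i y (rank ga (sig i)) 0.
Proof.
move=> cy; apply/colP => i.
have := congr1 (fun v : 'cV_m => v (rank ta (sig i)) 0) cy.
rewrite !mxE rankK => ->.
have bij_h : bijective (rank sig \o ga) by apply: bij_comp (rank_bij _) (item_bij _).
rewrite [RHS](reindex (rank sig \o ga)) /=; last exact: onW_bij.
by apply: eq_bigr => j _; rewrite mxE rankK itemK (run_B run) rankK itemK.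
Qed.

Lemma matA_unit : matA r \in unitmx.
Proof.
case: (run_umatch run) => _ uT _ _.
apply: perm_cols_unit (run_A run) (unitriangular_unit uT).
  by move=> i j; rewrite !itemK.
by move=> i j /rank_inj/(can_inj (@itemK _ _ be)).
Qed.

Lemma matB_unit : matB r \in unitmx.
Proof.
case: (run_umatch run) => _ _ uS _.
apply: perm_cols_unit (run_B run) (unitriangular_unit uS).
  by move=> i j /rank_inj/(can_inj (@itemK _ _ ta)).
by move=> i j /rank_inj/(can_inj (@itemK _ _ ga)).
Qed.

Lemma common_unit : common \in unitmx.
Proof.
case: (run_umatch' run) => _ uT' _ _.
by rewrite unitmx_mul matA_unit unitriangular_unit.
Qed.

Lemma matM'_unit : matM' r \in unitmx.
Proof.
case: (run_umatch' run) => TM uT' uS' _.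
have : matT' r *m matM' r \in unitmx.
  by rewrite TM !unitmx_mul unitmx_inv matA_unit matB_unit unitriangular_unit.
by rewrite unitmx_mul => /andP[].
Qed.

Lemma unitmx_row (A : 'M[K]_m) i : A \in unitmx -> exists j, A i j != 0.
Proof.
move=> uA; have : (A *m (invmx A *m delta_mx i 0)) i (0 : 'I_1) != 0.
  by rewrite mulKVmx // mxE !eqxx oner_eq0.
by case/mulmx_neq0 => j; exists j.
Qed.

(** The column of the nonzero entry of row i; it exists because M' is
    invertible, so that the default value never occurs. *)
Definition mate (i : 'I_m) : 'I_m := odflt i [pick j | matM' r i j != 0].

Lemma mateP i : matM' r i (mate i) != 0.
Proof.
rewrite /mate; case: pickP => //= H.
by have [j Mij] := unitmx_row i matM'_unit; rewrite H in Mij.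
Qed.

Lemma mate_eq i j : matM' r i j != 0 -> mate i = j.
Proof.
by case: (run_umatch' run) => _ _ _ [Mrow _]; apply/Mrow/mateP.
Qed.

(** The endpoints of the bar of the i-th representative, which is empty when
    they coincide. *)
Definition start (i : 'I_m) : nat := lker (ga (mate i)).
Definition stop (i : 'I_m) : nat := lim (be i).

Lemma vec_coords c : vec ta c = common *m coords c.
Proof. by rewrite mulKVmx ?common_unit. Qed.

Lemma mem_boundaries_coords t c : (1 <= t <= N)%N ->
  (c \in rel_boundaries (F t) (G t)) =
  supported (coords c) (fun i => (stop i <= t)%N).
Proof.
move=> tN; have := vec_coords c; rewrite -mulmxA matA_mul.
move/(mem_boundariesE tN)->; case: (run_umatch' run) => _ uT' _ _.
rewrite -(supported_unitriangular (coords c) uT'); last first.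
  by move=> i j ij; apply/leq_trans/(run_beta run).
apply/supportedP/supportedP => H i.
  by have := H (rank ta (be i)); rewrite mxE !(rankK, itemK).
by rewrite mxE => /H; rewrite /stop rankK.
Qed.

(** The relation A T' M' = B S' says that the columns of A T' and of B S' are
    equal up to order and scaling.  The latter are adapted to the cycles,
    because S' is unitriangular for the order in which f_ker increases, and so
    are therefore the columns of A T', which are also adapted to the
    boundaries. *)
Lemma mem_cycles_coords t c : (1 <= t <= N)%N ->
  (c \in rel_cycles (F t) (G t)) =
  supported (coords c) (fun i => (start i <= t)%N).
Proof.
move=> tN; case: (run_umatch' run) => TM uT' uS' [Mrow Mcol].
have [z cz] : exists z, coords c = matM' r *m z.
  by exists (invmx (matM' r) *m coords c); rewrite mulKVmx ?matM'_unit.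
have : vec ta c = matB r *m (matS' r *m z).
  rewrite vec_coords cz /common mulmxA -(mulmxA (matA r)) TM -!mulmxA.
  by rewrite mulKVmx ?matA_unit.
rewrite cz; move/matB_mul/(mem_cyclesE tN)->.
have -> : supported (matM' r *m z) (fun i => (start i <= t)%N) =
          supported z (fun j => (lker (ga j) <= t)%N).
  apply/supportedP/supportedP => H i => [zi|].
    have [j] := unitmx_row i (etrans (unitmx_tr _) matM'_unit); rewrite mxE => Mji.
    rewrite -(mate_eq Mji); apply: H; rewrite mxE (bigD1 i) //= big1 ?addr0.
      by rewrite mulf_neq0.
    move=> k ki; suff /eqP-> : matM' r j k == 0 by rewrite mul0r.
    by apply: contraNT ki => Mjk; apply/eqP/(Mrow j).
  by case/mulmx_neq0 => j Mij /H; rewrite /start (mate_eq Mij).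
rewrite -(supported_unitriangular z uS'); last first.
  by move=> i j ij; apply/leq_trans/(run_gamma run).
apply/supportedP/supportedP => H i.
  by have := H (rank sig (ga i)); rewrite mxE !(rankK, itemK).
by rewrite mxE => /H; rewrite rankK.
Qed.

Lemma coords_representative i : coords (representative r i) = delta_mx i 0.
Proof. by rewrite /coords vec_representative mulKmx ?common_unit. Qed.

Lemma run_representative_inj : injective (representative r).
Proof. exact: representative_inj common_unit. Qed.

Lemma start_range i : (1 <= start i <= N)%N.
Proof. exact: lookup_ker_range. Qed.

Lemma stop_range i : (1 <= stop i <= N)%N.
Proof. exact: lookup_im_range. Qed.

Lemma f_ker_representative i : f_ker F G (representative r i) = start i.
Proof.
apply: first_time_eq (start_range i) _ => t tN.
by rewrite mem_cycles_coords // coords_representative supported_delta.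
Qed.

Lemma f_im_representative i : f_im F G (representative r i) = stop i.
Proof.
apply: first_time_eq (stop_range i) _ => t tN.
by rewrite mem_boundaries_coords // coords_representative supported_delta.
Qed.

Lemma mem_output x : x \in output r ->
  {i | x = (start i, stop i, representative r i) & start i != stop i}.
Proof.
move=> xo.
pose P i := (x == (start i, stop i, representative r i)) && (start i != stop i).
have : exists i, P i.
  case/(run_output run): xo => i [j [Mij ne x_eq]].
  by exists i; rewrite /P x_eq /start (mate_eq Mij) eqxx.
by case/sigW => i /andP[/eqP]; exists i.
Qed.

Lemma output_mem i : start i != stop i ->
  (start i, stop i, representative r i) \in output r.
Proof.
by move=> ne; apply/(run_output run); exists i, (mate i); split=> //; apply: mateP.
Qed.

Hypothesis GF : forall k, (1 <= k <= N)%N -> G k \subset F k.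

Lemma mem_span_boundary (A : {set X}) c :
  subcomplex A -> c \in span_cells A -> boundary X c \in span_cells A.
Proof.
rewrite !mem_span_cells => subA /'forall_implyP cA; apply/'forall_implyP => y.
rewrite boundaryE; apply: contraR => yA; apply/eqP/big1 => x _.
case: (eqVneq (c x) 0) => [->|/cA xA]; first by rewrite mul0r.
suff /eqP-> : inc x y == 0 by rewrite mulr0.
by apply: contraNT yA; apply: subA.
Qed.

Lemma boundary_boundary c : boundary X (boundary X c) = 0.
Proof.
apply/ffunP => z; rewrite boundaryE ffunE.
under eq_bigr do rewrite boundaryE mulr_suml.
rewrite exchange_big big1 //= => x _.
under eq_bigr do rewrite -mulrA.
by rewrite -mulr_sumr [X in _ * X](inc_inc x z) mulr0.
Qed.

(** The pair (F t, G t) has a relative homology because G t is a subcomplex of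
    F t and the boundary of a boundary vanishes. *)
Lemma boundaries_sub_cycles t : (1 <= t <= N)%N ->
  (rel_boundaries (F t) (G t) <= rel_cycles (F t) (G t))%VS.
Proof.
move=> tN; apply/subvP => c /mem_rel_boundaries[b [g [bF gG ->]]].
rewrite mem_rel_cycles linearD /= boundary_boundary add0r.
rewrite (mem_span_boundary (@stage_subcomplex _ _ _ _ _) gG) andbT.
rewrite memvD ?(mem_span_boundary (@stage_subcomplex _ _ _ _ _) bF) //.
exact: subvP (span_cellsS (GF tN)) _ gG.
Qed.

Lemma start_leq_stop i : (start i <= stop i)%N.
Proof.
have tN := stop_range i.
have := subvP (boundaries_sub_cycles tN) (representative r i).
rewrite mem_boundaries_coords // mem_cycles_coords //.
by rewrite coords_representative !supported_delta; apply.
Qed.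

(** ** The decomposition into interval modules *)

Local Notation bars := [seq x.1 | x <- output r].
Local Notation H := (rel_homology F G).

Lemma output_index (k : 'I_(size bars)) :
  {i | nth (0%N, 0%N, 0) (output r) k = (start i, stop i, representative r i)
     & start i != stop i}.
Proof. by apply/mem_output/mem_nth; have := ltn_ord k; rewrite {2}size_map. Qed.

(** The output lists the bars in an arbitrary order; this recovers the index
    of the representative from the triple listed. *)
Definition index_of (k : 'I_(size bars)) : 'I_m := s2val (output_index k).

Lemma nth_output (k : 'I_(size bars)) : nth (0%N, 0%N, 0) (output r) k =
  (start (index_of k), stop (index_of k), representative r (index_of k)).
Proof. exact: (s2valP (output_index k)). Qed.

Lemma index_of_inj : injective index_of.
Proof.
move=> k l e; apply/val_inj/eqP => /=.
rewrite -(nth_uniq (0%N, 0%N, 0) _ _ (run_output_uniq run)); last 2 first.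
- by have := ltn_ord k; rewrite {2}size_map.
- by have := ltn_ord l; rewrite {2}size_map.
by rewrite !nth_output e.
Qed.

Lemma index_of_onto i : start i != stop i -> exists k, index_of k = i.
Proof.
move=> /output_mem io.
have lt : (index (start i, stop i, representative r i) (output r) < size bars)%N.
  by rewrite size_map index_mem.
exists (Ordinal lt); have := nth_output (Ordinal lt).
by rewrite /= nth_index // => -[_ _ /run_representative_inj].
Qed.

Lemma aliveE t (k : 'I_(size bars)) :
  alive bars t k = (start (index_of k) <= t < stop (index_of k))%N.
Proof.
rewrite /alive /bar (nth_map (0%N, 0%N, 0)) ?nth_output //.
by have := ltn_ord k; rewrite {2}size_map.
Qed.

Definition chain_of t (f : interval_sum K bars t) : chain :=
  \sum_k f k *: representative r (index_of (val k)).

Definition class_map_fun t (f : interval_sum K bars t) : H t :=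
  rel_class F G t (chain_of f).

Fact class_map_is_linear t : linear (@class_map_fun t).
Proof.
move=> a f g; rewrite /class_map_fun /rel_class -linearP -linearP.
congr (quot_pi _ (vsproj _ _)); rewrite /chain_of scaler_sumr -big_split /=.
by apply: eq_bigr => k _; rewrite !ffunE scalerDl scalerA.
Qed.
HB.instance Definition _ t :=
  GRing.isLinear.Build K (interval_sum K bars t) (H t) *:%R (@class_map_fun t)
    (@class_map_is_linear t).

Definition class_map t : {linear interval_sum K bars t -> H t} :=
  @class_map_fun t.

Lemma coords_chain_of t (f : interval_sum K bars t) k :
  coords (chain_of f) (index_of (val k)) 0 = f k.
Proof.
rewrite /chain_of linear_sum summxE (bigD1 k) //= big1 => [|l lk].
  by rewrite linearZ /= coords_representative !mxE !eqxx mulr1 addr0.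
rewrite linearZ /= coords_representative !mxE (inj_eq index_of_inj).
by rewrite eq_sym (inj_eq val_inj) (negPf lk) mulr0.
Qed.

Lemma coords_chain_of0 t (f : interval_sum K bars t) i :
  (forall k : {k : 'I_(size bars) | alive bars t k}, index_of (val k) != i) ->
  coords (chain_of f) i 0 = 0.
Proof.
move=> Hi; rewrite /chain_of linear_sum summxE big1 // => k _.
by rewrite linearZ /= coords_representative !mxE eq_sym (negPf (Hi k)) mulr0.
Qed.

Lemma chain_of_cycle t (f : interval_sum K bars t) : (1 <= t <= N)%N ->
  chain_of f \in rel_cycles (F t) (G t).
Proof.
move=> tN; apply: memv_suml => k _; apply: memvZ.
rewrite mem_cycles_coords // coords_representative supported_delta.
by have := valP k; rewrite aliveE => /andP[].
Qed.

Lemma alive_index t i : (start i <= t < stop i)%N ->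
  exists k : {k : 'I_(size bars) | alive bars t k}, index_of (val k) = i.
Proof.
move=> ti; have : start i != stop i.
  by case/andP: ti => a b; rewrite neq_ltn (leq_ltn_trans a b).
case/index_of_onto => k ki; have ak : alive bars t k by rewrite aliveE ki.
by exists (Sub k ak); rewrite SubK.
Qed.

Definition class_coords t (h : H t) : interval_sum K bars t :=
  [ffun k => coords (vsval (quot_repr h)) (index_of (val k)) 0].

(** At time t the classes of the representatives alive form a basis: those
    which are not yet cycles do not occur in a cycle, and those which are
    already boundaries vanish in homology. *)
Lemma class_map_bij t : (1 <= t <= N)%N -> bijective (class_map t).
Proof.
move=> tN; exists (@class_coords t) => [f|h].
  apply/ffunP => k; rewrite ffunE -[RHS](coords_chain_of f).
  have : vsval (quot_repr (class_map t f)) - chain_of f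
           \in rel_boundaries (F t) (G t).
    rewrite -[X in _ - X](vsprojK (chain_of_cycle f tN)).
    by apply/quot_piP; rewrite quot_reprK.
  rewrite mem_boundaries_coords // => /supportedP/(_ (index_of (val k))).
  have := valP k; rewrite aliveE => /andP[_ kt]; rewrite leqNgt kt.
  rewrite linearB !mxE => /contraTeq/(_ isT)/eqP.
  by rewrite subr_eq0 => /eqP.
rewrite -[RHS]quot_reprK; apply/quot_piP.
rewrite vsprojK ?chain_of_cycle // mem_boundaries_coords //.
apply/supportedP => i; rewrite linearB; apply: contraR; rewrite -ltnNge => ti.
rewrite mxE [X in _ + X]mxE.
case: (leqP (start i) t) => si.
  have [|k <-] := @alive_index t i; first by rewrite si.
  by rewrite coords_chain_of ffunE subrr.
rewrite coords_chain_of0 => [|k]; last first.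
  by apply: contraTneq (valP k) => ki; rewrite aliveE ki leqNgt si.
have := subvsP (quot_repr h); rewrite mem_cycles_coords // => /supportedP/(_ i).
by rewrite leqNgt si => /contraTeq/(_ isT)->; rewrite subrr.
Qed.

(** A bar which ends at t + 1 has a boundary as its representative there; a
    bar which starts at t + 1 does not meet the image of the map. *)
Lemma class_map_natural t (f : interval_sum K bars t) : (1 <= t < N)%N ->
  Defs.pmap H t (class_map t f) =
  class_map t.+1 (Defs.pmap (interval_sum K bars) t f).
Proof.
move=> /andP[t1 tN]; have tN1 : (1 <= t <= N)%N by rewrite t1 ltnW.
have tN2 : (1 <= t.+1 <= N)%N by [].
rewrite /= /rel_homology_map quot_map_pi ?rel_cyclesS ?rel_boundariesS ?stage_le //.
have sZ := rel_cyclesS (stage_le F (leqnSn t)) (stage_le G (leqnSn t)).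
have Zf := subvP sZ _ (chain_of_cycle f tN1).
apply/quot_piP; rewrite !vsprojK ?chain_of_cycle //.
rewrite mem_boundaries_coords //.
apply/supportedP => i; rewrite linearB; apply: contraR; rewrite -ltnNge => ti.
rewrite mxE [X in _ + X]mxE.
case: (leqP (start i) t) => si.
  have [|k ki] := @alive_index t i; first by rewrite si ltnW.
  have [|l li] := @alive_index t.+1 i; first by rewrite leqW.
  have kl : val k = val l by apply: index_of_inj; rewrite ki li.
  rewrite -{1}ki -li !coords_chain_of ffunE -kl valK /= subrr //.
rewrite coords_chain_of0 => [|k]; last first.
  by apply: contraTneq (valP k) => ki; rewrite aliveE ki leqNgt si.
case: (leqP (start i) t.+1) => si'.
  have [|l li] := @alive_index t.+1 i; first by rewrite si'.
  rewrite -li coords_chain_of ffunE; case: insubP => [u|]; last by rewrite subrr.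
  by rewrite aliveE li leqNgt si.
rewrite coords_chain_of0 ?subrr // => k.
by apply: contraTneq (valP k) => ki; rewrite aliveE ki leqNgt si'.
Qed.

Theorem run_correct : correct F G r.
Proof.
split; [exact: lookup_kerE | exact: lookup_imE | |].
  move=> x /mem_output[i -> _].
  by rewrite f_ker_representative f_im_representative.
split.
- move=> _ /mapP[x /mem_output[i -> ne] ->] /=.
   case/andP: (start_range i) => -> _.
  by rewrite ltn_neqAle ne start_leq_stop.
- move=> x /mem_output[i -> _] /=; rewrite mem_cycles_coords ?start_range //.
  by rewrite coords_representative supported_delta.
- exists class_map => [|t k tN].
    by split=> [t tN|t tN f]; [apply: class_map_bij | apply: class_map_natural].
  congr (rel_class _ _ _ _); rewrite nth_output /= /chain_of (bigD1 k) //= big1.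
    by rewrite ffunE eqxx scale1r addr0.
  by move=> l lk; rewrite ffunE (negPf lk) scale0r.
Qed.

End AdaptedBases.

(** * The random access machine *)

Section Machine.
Variable K : fieldType.
Implicit Type s : memory K.

Definition run p s := (exec p s).1.

Lemma run_seq p q s : run (Seq p q) s = run q (run p s).
Proof. by rewrite /run /=; case: (exec p s) => s1 k1; case: exec. Qed.

Lemma run_if b p q s : run (If b p q) s = run (if Defs.tval s b then p else q) s.
Proof. by rewrite /run /=; case: exec. Qed.

Lemma run_for x e p s :
  run (For x e p) s =
  iteri (ival s e) (fun v s' => run p (set_nat s' x 0 v)) s.
Proof.
rewrite /run /=; elim: (ival s e) => //= n IH.
by case: exec (congr1 (fun s' => exec p (set_nat s' x 0 n)) IH) => s1 k1 <-.
Qed.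

Fixpoint nat_writes p : seq nat :=
  match p with
  | ISet x _ _ => [:: x]
  | Seq p q | If _ p q => nat_writes p ++ nat_writes q
  | For x _ p => x :: nat_writes p
  | _ => [::]
  end.

Fixpoint elt_writes p : seq nat :=
  match p with
  | KSet x _ _ _ => [:: x]
  | Seq p q | If _ p q => elt_writes p ++ elt_writes q
  | For _ _ p => elt_writes p
  | _ => [::]
  end.

Lemma run_nats p s x i :
  x \notin nat_writes p -> nats (run p s) x i = nats s x i.
Proof.
elim: p s => //= [y e1 e2|p IHp q IHq|b p IHp q IHq|y e p IH] s.
- by rewrite inE => /negPf /= ->.
- by rewrite mem_cat negb_or run_seq => /andP[xp xq]; rewrite IHq ?IHp.
- by rewrite mem_cat negb_or run_if => /andP[xp xq]; case: ifP; auto.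
- rewrite inE negb_or run_for => /andP[xy xp].
  by elim: (ival s e) => //= n; rewrite IH //= (negPf xy).
Qed.

Lemma run_elts p s x i j :
  x \notin elt_writes p -> elts (run p s) x i j = elts s x i j.
Proof.
elim: p s => //= [y e1 e2 e3|p IHp q IHq|b p IHp q IHq|y e p IH] s.
- by rewrite inE => /negPf /= ->.
- by rewrite mem_cat negb_or run_seq => /andP[xp xq]; rewrite IHq ?IHp.
- by rewrite mem_cat negb_or run_if => /andP[xp xq]; case: ifP; auto.
- by rewrite run_for => xp; elim: (ival s e) => //= n; rewrite IH.
Qed.

Definition cell_count : iexp := IGet in_size (ICst 0).
Definition loop x p := For x cell_count p.

(** The invariant only has to speak of the arrays which the body writes: for
    the others, the induction step is given that they have kept their contents
    since the loop was entered. *)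
Lemma loop_ind (I : nat -> memory K -> Prop) x p s m :
  nats s in_size 0 = m -> I 0%N s ->
  (forall v s', (v < m)%N ->
     (forall (y i : nat), y \notin x :: nat_writes p -> nats s' y i = nats s y i) ->
     (forall (y i j : nat), y \notin elt_writes p ->
       elts s' y i j = elts s y i j) ->
     I v s' -> I v.+1 (run p (set_nat s' x 0 v))) ->
  I m (run (loop x p) s).
Proof.
move=> sm I0 IS; rewrite run_for /= sm.
suff [] : [/\ I m (iteri m (fun v s' => run p (set_nat s' x 0 v)) s),
   forall y i, y \notin x :: nat_writes p ->
     nats (iteri m (fun v s' => run p (set_nat s' x 0 v)) s) y i = nats s y i &
   forall y i j, y \notin elt_writes p ->
     elts (iteri m (fun v s' => run p (set_nat s' x 0 v)) s) y i j =
     elts s y i j] by [].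
elim: {sm}m IS => //= n IH IS.
have [|IHI IHn IHe] := IH; first by move=> v s' vn; apply/IS/ltnW.
split=> [|y i yp|y i j yp]; first exact: IS.
  rewrite run_nats; last by move: yp; rewrite inE negb_or => /andP[].
  by rewrite /= IHn //; move: yp; rewrite inE negb_or => /andP[/negPf-> _].
by rewrite run_elts // IHe.
Qed.

(** ** Cost *)

(** All loops run over the cells and the number of cells is never modified,
    so that the cost is bounded by a polynomial in it whose degree is the
    nesting depth. *)
Fixpoint bounded p : bool :=
  match p with
  | Skip | KSet _ _ _ _ => true
  | ISet x _ _ => x != in_size
  | Seq p q | If _ p q => bounded p && bounded q
  | For x (IGet y (ICst z)) p =>
      [&& x != in_size, y == in_size, z == 0%N & bounded p]
  | For _ _ _ => false
  end.

Fixpoint depth p : nat :=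
  match p with
  | Seq p q | If _ p q => maxn (depth p) (depth q)
  | For _ _ p => (depth p).+1
  | _ => 0
  end.

Fixpoint weight p : nat :=
  match p with
  | Skip => 1
  | ISet _ e1 e2 => (icost e1 + icost e2).+1
  | KSet _ e1 e2 e3 => (icost e1 + icost e2 + kcost e3).+1
  | Seq p q => weight p + weight q
  | If b p q => (tcost b + (weight p + weight q)).+1
  | For _ e p => icost e + weight p + 2
  end.

Lemma bounded_size p : bounded p -> in_size \notin nat_writes p.
Proof.
elim: p => //= [x e1 e2|p IHp q IHq|b p IHp q IHq|x e p IH].
- by rewrite inE eq_sym.
- by rewrite mem_cat negb_or => /andP[/IHp-> /IHq->].
- by rewrite mem_cat negb_or => /andP[/IHp-> /IHq->].
- by case: e => // y [] // z /and4P[xn _ _ /IH]; rewrite inE negb_or eq_sym xn.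
Qed.

Lemma exec_cost p s m : (1 <= m)%N -> nats s in_size 0 = m -> bounded p ->
  ((exec p s).2 <= weight p * m ^ depth p)%N.
Proof.
move=> m1.
elim: p s => [|x e1 e2|x e1 e2 e3|p IHp q IHq|b p IHp q IHq|x e p IH] s sm bp;
  rewrite ?muln1 //.
- have /andP[bp1 bq] : bounded p && bounded q by [].
  have := IHp s sm bp1; have := run_nats s 0 (bounded_size bp1); rewrite sm /run /=.
  case: (exec p s) => s1 k1 /= s1m pk; have := IHq s1 s1m bq.
  case: (exec q s1) => s2 k2 /= qk; rewrite mulnDl leq_add //.
    by apply: leq_trans pk _; rewrite leq_mul2l leq_pexp2l ?leq_maxl ?orbT.
  by apply: leq_trans qk _; rewrite leq_mul2l leq_pexp2l ?leq_maxr ?orbT.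
- have /andP[bp1 bq] : bounded p && bounded q by [].
  have mm : (1 <= m ^ maxn (depth p) (depth q))%N by rewrite expn_gt0 m1.
  have -> : (exec (If b p q) s).2 =
            (tcost b + (exec (if Defs.tval s b then p else q) s).2).+1.
    by rewrite /=; case: exec.
  rewrite [X in (_ <= X * _)%N]/= mulSn mulnDl -add1n !leq_add ?leq_pmulr //.
  rewrite mulnDl; case: ifP => _.
    apply: leq_trans (IHp s sm bp1) (leq_trans _ (leq_addr _ _)).
    by rewrite leq_mul2l leq_pexp2l ?leq_maxl ?orbT.
  apply: leq_trans (IHq s sm bq) (leq_trans _ (leq_addl _ _)).
  by rewrite leq_mul2l leq_pexp2l ?leq_maxr ?orbT.
- move: bp; rewrite /=; case: e => // y [] // z /and4P[xn /eqP-> /eqP-> bp] /=.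
  rewrite sm.
  set f := fun v sk => _.
  suff /(_ m)[_ /leq_trans] : forall n,
     nats (iteri n f (s, 3%N)).1 in_size 0 = m /\
     ((iteri n f (s, 3)).2 <= 3 + n * (weight p * m ^ depth p + 1))%N.
    apply; rewrite expnS mulnDr addnA.
    have mm : (m <= m * m ^ depth p)%N by rewrite leq_pmulr // expn_gt0 m1.
    have m3 : (1 <= m * m ^ depth p)%N by apply: leq_trans mm.
    by rewrite muln1 mulnCA !mulnDl; lia.
  elim=> //= n [IHn IHc]; rewrite {1 3}/f; set sk := iteri n f _ in IHn IHc *.
  have sn : nats (set_nat sk.1 x 0 n) in_size 0 = m.
    by rewrite /= eq_sym (negPf xn).
  have := IH _ sn bp; have := run_nats (set_nat sk.1 x 0 n) 0 (bounded_size bp).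
  rewrite sn /run; case: exec => s1 k1 /= -> ck; split=> //.
  by rewrite mulSn; lia.
Qed.

End Machine.

(** The side conditions on concrete addresses are decided by conversion: the
    rewriting with isT fails on the arrays which the loop does write. *)
Ltac unwritten :=
  repeat match goal with
  | H : (forall y i, _ -> nats ?s y i = _) |- context [nats ?s ?y ?i] =>
      rewrite (H y i isT)
  | H : (forall y i j, _ -> elts ?s y i j = _) |- context [elts ?s ?y ?i ?j] =>
      rewrite (H y i j isT)
  end.

Ltac step :=
  rewrite ?run_seq ?run_if /=; repeat (progress unwritten; rewrite /=).

(** * Sorting by counting *)

(** Loop counters and other scalars are kept in entry 0 of their array. *)
Definition loop1 := 20%N.
Definition loop2 := 21%N.
Definition loop3 := 22%N.
Definition counter := 23%N.
Definition row_reg := 24%N.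
Definition found := 25%N.
Definition col_reg := 26%N.
Definition keys := 30%N.
Definition ranks := 31%N.
Definition listed := 32%N.

Definition var x := IGet x (ICst 0).

Definition sort_count : program :=
  Seq (ISet counter (ICst 0) (ICst 0))
  (Seq (loop loop2
    (If (TLeq (IAdd (var loop2) (ICst 1)) (var loop1))
      (If (TLeq (IGet keys (var loop2)) (IGet keys (var loop1)))
        (ISet counter (ICst 0) (IAdd (var counter) (ICst 1))) Skip)
      (If (TLeq (IAdd (IGet keys (var loop2)) (ICst 1)) (IGet keys (var loop1)))
        (ISet counter (ICst 0) (IAdd (var counter) (ICst 1))) Skip)))
  (Seq (ISet ranks (var loop1) (var counter))
       (ISet listed (var counter) (var loop1)))).

Definition counting_sort : program := loop loop1 sort_count.

Section SortOrder.
Variables (m : nat) (key : nat -> nat).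

(** Ties are broken by the index, which makes this a strict total order and
    the number of predecessors a bijection. *)
Definition before (j i : nat) : bool :=
  if (j < i)%N then (key j <= key i)%N else (key j < key i)%N.

Definition position (i : nat) : nat := count (before ^~ i) (iota 0 m).

Lemma before_trans : transitive before.
Proof. by move=> y x z; rewrite /before; do 3!case: ifP; lia. Qed.

Lemma position_mono (j i : nat) :
  (j < m)%N -> before j i -> (position j < position i)%N.
Proof.
move=> jm ji; rewrite /position.
have split_j p : count p (iota 0 m) = (p j + count p (rem j (iota 0 m)))%N.
  have jin : j \in iota 0 m by rewrite mem_iota.
  by rewrite (seq.permP (perm_to_rem jin)).
rewrite !split_j ji /before ltnn ltnn add0n ltnS.
by apply: sub_count => k /before_trans; apply.
Qed.

Lemma position_lt i : (i < m)%N -> (position i < m)%N.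
Proof.
move=> im; rewrite -[X in (_ < X)%N](size_iota 0) ltn_neqAle.
rewrite count_size andbT -all_count; apply/allPn; exists i; first by rewrite mem_iota.
by rewrite /= /before !ltnn.
Qed.

Lemma position_inj i j : (i < m)%N -> (j < m)%N -> position i = position j -> i = j.
Proof.
move=> im jm e; have := position_mono im (i := j); have := position_mono jm (i := i).
rewrite e ltnn /before; do 2!case: ifP; lia.
Qed.

End SortOrder.

Section SortRun.
Variable K : fieldType.
Implicit Type s : memory K.

Lemma sort_run s m : nats s in_size 0 = m ->
  forall i, (i < m)%N ->
    nats (run counting_sort s) ranks i = position m (nats s keys) i /\
    nats (run counting_sort s) listed (position m (nats s keys) i) = i.
Proof.
move=> sm.
pose I v s' := forall i, (i < v)%N ->
  nats s' ranks i = position m (nats s keys) i /\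
  nats s' listed (position m (nats s keys) i) = i.
apply: (loop_ind (I := I) sm) => // v s' vm frn _ IH.
rewrite /sort_count !run_seq.
set s1 := run (ISet counter _ _) _.
have s1m : nats s1 in_size 0 = m by rewrite /s1 /=; unwritten.
set s2 := run (loop loop2 _) s1.
have s2c : nats s2 counter 0 = position m (nats s keys) v.
  pose J w s'' := nats s'' counter 0 = count (before (nats s keys) ^~ v) (iota 0 w).
  apply: (loop_ind (I := J) s1m) => // w s'' wm frn' _.
  rewrite /J -[w.+1]addn1 iotaD count_cat add0n /= addn0 => IHw.
  step; rewrite [before _ w v]/before addn1.
  case: ifP => _; step.
    by case: ifP => _; rewrite /= IHw ?addn0.
  by rewrite addn1; case: ifP => _; rewrite /= IHw ?addn0.
move=> i; rewrite ltnS leq_eqVlt /= s2c [nats s2 loop1 0]run_nats //=.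
case/predU1P => [->|iv].
  by rewrite !eqxx.
have im := ltn_trans iv vm.
rewrite (ltn_eqF iv) (_ : _ == _ = false).
  rewrite !run_nats //=; exact: IH.
by apply: contraTF iv => /eqP/(position_inj im vm)->; rewrite ltnn.
Qed.

End SortRun.

(** * U-match decompositions by elimination *)

Section Elimination.
Variables (K : fieldType) (m : nat) (D : 'M[K]_m).
Implicit Types (R S T M : 'M[K]_m) (u : pred 'I_m).

(** The state after the v lowest rows have been processed.  The columns in u
    are those which contain a pivot; the others have been cleared in the rows
    processed so far. *)
Record eliminated (v : nat) R S T M u : Prop := Eliminated {
  elim_product : D *m S = R;
  elim_S : upper_unitriangular S;
  elim_T : upper_unitriangular T;
  elim_M : matching M;
  elim_used : forall r l, u l -> (T *m M) r l = R r l;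
  elim_cleared : forall r l : 'I_m, ~~ u l -> (m <= r + v)%N -> R r l = 0;
  elim_unused : forall r l, ~~ u l -> M r l = 0;
  elim_above : forall r l : 'I_m, (r + v < m)%N -> M r l = 0
}.

Lemma unitriangular1 : upper_unitriangular (1%:M : 'M[K]_m).
Proof.
split=> [i|i j ji]; first by rewrite mxE eqxx.
by rewrite mxE -val_eqE /= gtn_eqF.
Qed.

Lemma eliminated0 : eliminated 0 D 1%:M 1%:M 0 pred0.
Proof.
split=> //; try exact: unitriangular1.
- by rewrite mulmx1.
- by split=> [i j j'|i i' j]; rewrite mxE eqxx.
- by move=> r l _; rewrite addn0 leqNgt ltn_ord.
- by move=> r l _; rewrite mxE.
- by move=> r l _; rewrite mxE.
Qed.

Lemma eliminated_umatch R S T M u : eliminated m R S T M u -> umatch T M D S.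
Proof.
case=> DS uS uT mM used cleared unused _; split=> //.
rewrite DS; apply/matrixP => r l; case: (boolP (u l)) => ul; first exact: used.
rewrite cleared // ?leq_addl // mxE big1 // => k _.
by rewrite unused // mulr0.
Qed.

Lemma eq_eliminated v R S T M u u' :
  u =1 u' -> eliminated v R S T M u -> eliminated v R S T M u'.
Proof. by move=> uu' []; split=> // r l; rewrite -uu'; auto. Qed.

Lemma eliminated_skip v R S T M u (i : 'I_m) : (i + v.+1 = m)%N ->
  (forall l, ~~ u l -> R i l = 0) ->
  eliminated v R S T M u -> eliminated v.+1 R S T M u.
Proof.
move=> iv Ri0 [DS uS uT mM used cleared unused above]; split=> //.
  move=> r l ul; rewrite addnS leq_eqVlt ltnS => /predU1P[rv|]; last exact: cleared.
  suff -> : r = i by apply: Ri0.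
  by apply/val_inj => /=; lia.
by move=> r l rv; apply: above; lia.
Qed.

Definition factor R u (i j l : 'I_m) : K :=
  if ~~ u l && (j < l)%N then R i l / R i j else 0.

(** The pivot is the leftmost nonzero entry of its row among the columns
    without a pivot, so that only columns to its right have to be cleared and
    S stays unitriangular.  The pivot column vanishes below the pivot; divided
    by the pivot it is the column of T indexed by the row of the pivot, and no
    later step modifies it. *)
Lemma eliminated_pivot v R S T M u (i j : 'I_m) R' S' T' M' u' :
  (i + v.+1 = m)%N -> ~~ u j -> R i j != 0 ->
  (forall l : 'I_m, (l < j)%N -> ~~ u l -> R i l = 0) ->
  (forall r l, R' r l = R r l - factor R u i j l * R r j) ->
  (forall r l, S' r l = S r l - factor R u i j l * S r j) ->
  (forall r l, T' r l = if l == i then R r j / R i j else T r l) ->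
  (forall r l, M' r l = if (r == i) && (l == j) then R i j else M r l) ->
  (forall l, u' l = u l || (l == j)) ->
  eliminated v R S T M u -> eliminated v.+1 R' S' T' M' u'.
Proof.
move=> iv uj Rij left_j R'E S'E T'E M'E u'E.
case=> DS [S1 S0] [T1 T0] [Mrow Mcol] used cleared unused above.
have fu l : u l -> factor R u i j l = 0 by rewrite /factor => ->.
have fl (l : 'I_m) : (l <= j)%N -> factor R u i j l = 0.
  by rewrite /factor ltnNge => ->; rewrite andbF.
have Mi l : M i l = 0 by apply: above; lia.
have Mj r : M r j = 0 by apply: unused.
split.
- apply/matrixP => r l; rewrite R'E -DS !mxE mulr_sumr -sumrB.
  by apply: eq_bigr => k _; rewrite S'E -DS mulrBr mulrCA.
- split=> [r|r l lr]; rewrite S'E.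
    rewrite S1; case: (leqP r j) => rj; first by rewrite fl // mul0r subr0.
    by rewrite S0 // mulr0 subr0.
  rewrite S0 //; case: (leqP l j) => lj; first by rewrite fl // mul0r subr0.
  by rewrite S0 ?mulr0 ?subr0 // (ltn_trans lj).
- split=> [r|r l lr]; rewrite T'E.
    by case: eqP => [->|_]; [rewrite divff | exact: T1].
  case: eqP => [eli|_]; last exact: T0.
  by rewrite cleared ?mul0r //; rewrite eli in lr; lia.
- split=> [r l l'|r r' l]; rewrite !M'E.
    case: (eqVneq r i) => [->|_] /=; last exact: Mrow.
    by rewrite !Mi; case: (eqVneq l j) (eqVneq l' j) => [->|_] [->|_]; rewrite ?eqxx.
  case: (eqVneq l j) => [->|_] /=; rewrite ?andbF ?andbT; last exact: Mcol.
  by rewrite !Mj; case: (eqVneq r i) (eqVneq r' i) => [->|_] [->|_]; rewrite ?eqxx.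
- move=> r l; rewrite u'E R'E mxE; case: (eqVneq l j) => [-> _|lj] /=.
    rewrite fl // mul0r subr0 (bigD1 i) //= big1 => [|k ki].
      by rewrite T'E M'E !eqxx divfK // addr0.
    by rewrite M'E (negPf ki) Mj mulr0.
  rewrite orbF => ul; rewrite fu // mul0r subr0 -used // mxE.
  apply: eq_bigr => k _; rewrite M'E (negPf lj) andbF T'E.
  by case: eqP => // ->; rewrite Mi !mulr0.
- move=> r l; rewrite u'E negb_or => /andP[ul lj] rv; rewrite R'E.
  have [ri|ri] := eqVneq r i; last first.
    have rv' : (m <= r + v)%N by move: rv ri; rewrite -val_eqE /=; lia.
    by rewrite !cleared // mulr0 subr0.
  rewrite ri /factor ul /=; case: ltngtP => [jl|jl|/val_inj jl].
  + by rewrite divfK ?subrr.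
  + by rewrite mul0r subr0 left_j.
  + by rewrite jl eqxx in lj.
- move=> r l; rewrite u'E negb_or => /andP[ul /negPf lj].
  by rewrite M'E lj andbF unused.
- move=> r l rv; rewrite M'E; case: eqP => [ri|_] /=; last by apply: above; lia.
  by rewrite ri in rv; lia.
Qed.

End Elimination.

(** * Elementary procedures *)

Definition entry x : kexp := KGet x (var loop1) (var loop2).

Definition fill x (e : kexp) : program :=
  loop loop1 (loop loop2 (KSet x (var loop1) (var loop2) e)).

Definition copy x y : program :=
  loop loop1 (ISet y (var loop1) (IGet x (var loop1))).

Definition sort_into x y z : program :=
  Seq (copy x keys) (Seq counting_sort (Seq (copy listed y) (copy ranks z))).

Section Procedures.
Variables (K : fieldType) (m : nat).
Implicit Type s : memory K.

Definition mx s x : 'M[K]_m := \matrix_(i, j) elts s x i j.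

(** The expression may read the entry which it overwrites, but no other entry
    of the array x. *)
Lemma fill_run s x e (A : 'M[K]_m) : nats s in_size 0 = m ->
  (forall s' (i j : 'I_m),
     (forall y k : nat, y \notin [:: loop1; loop2] -> nats s' y k = nats s y k) ->
     (forall y k l : nat, y != x -> elts s' y k l = elts s y k l) ->
     elts s' x i j = elts s x i j ->
     nats s' loop1 0 = i -> nats s' loop2 0 = j -> kval s' e = A i j) ->
  mx (run (fill x e) s) x = A.
Proof.
move=> sm eA.
pose I v s' := forall i j : 'I_m,
  elts s' x i j = if (i < v)%N then A i j else elts s x i j.
suff H : I m (run (fill x e) s) by apply/matrixP => i j; rewrite mxE H ltn_ord.
apply: (loop_ind (I := I) sm) => // v s1 vm frn1 fre1 IH.
set s1' := set_nat _ _ _ _; have s1m : nats s1' in_size 0 = m by step.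
pose J w s' := forall i j : 'I_m, elts s' x i j =
  if (i < v)%N || (i == v :> nat) && (j < w)%N then A i j else elts s x i j.
suff H : J m (run (loop loop2 (KSet x (var loop1) (var loop2) e)) s1').
  by move=> i j; rewrite H ltn_ord andbT orbC -leq_eqVlt ltnS.
apply: (loop_ind (I := J) s1m) => [i j|w s2 wm frn2 fre2 IH2 i j].
  by rewrite ltn0 andbF orbF IH.
rewrite /= eqxx frn2 //= IH2 ltnS [(j <= w)%N]leq_eqVlt.
have [iv|] := eqVneq (i : nat) v => //=; have [jw|] := eqVneq (j : nat) w => //=.
rewrite orbT; apply: eA => [y k|y k l yx|||] /=; rewrite ?iv ?jw //.
- rewrite !inE negb_or => /andP[/negPf y1 /negPf y2].
  by rewrite y2 frn2 ?inE ?y2 //= y1 frn1 // !inE y1 y2.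
- by rewrite fre2 ?inE // fre1 ?inE.
- by rewrite -iv -jw IH2 iv jw !ltnn andbF.
- by rewrite frn2.
Qed.

Lemma copy_run s x y : nats s in_size 0 = m -> x != loop1 -> x != y ->
  y != loop1 -> y != in_size ->
  forall i : 'I_m, nats (run (copy x y) s) y i = nats s x i.
Proof.
move=> sm x1 xy y1 y0.
pose I v s' := forall i : 'I_m, (i < v)%N -> nats s' y i = nats s x i.
suff H : I m (run (copy x y) s) by move=> i; apply: H.
apply: (loop_ind (I := I) sm) => // v s' vm frn _ IH i; rewrite ltnS => iv.
rewrite /= eqxx (negPf x1) (negPf y1) /= frn ?inE ?negb_or ?x1 ?xy //.
by case: eqP => [->|ne] //; apply: IH; rewrite ltn_neqAle iv andbT; apply/eqP.
Qed.

(** The permutation p sends a cell to its position in the sorted order. *)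
Lemma sort_perm s : nats s in_size 0 = m ->
  exists p : {perm 'I_m},
    [/\ forall i : 'I_m, nats (run counting_sort s) ranks i = p i,
        forall i : 'I_m, nats (run counting_sort s) listed i = (p^-1)%g i &
        forall i j : 'I_m, (i <= j)%N ->
          (nats s keys ((p^-1)%g i) <= nats s keys ((p^-1)%g j))%N].
Proof.
move=> sm; set key := nats s keys.
pose f (i : 'I_m) := Ordinal (position_lt key (ltn_ord i)).
have f_inj : injective f.
  by move=> i j [] /position_inj e; apply/val_inj/e.
exists (perm f_inj); have rk i := sort_run sm (ltn_ord i).
have fK i : position m key ((perm f_inj)^-1%g i) = i.
  by have /(congr1 val) := permKV (perm f_inj) i; rewrite permE.
split=> [i|i|i j ij].
- by rewrite permE; case: (rk i).
- by rewrite -{1}(fK i); case: (rk ((perm f_inj)^-1%g i)).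
- rewrite leqNgt; apply/negP => ji.
  have bji : before key ((perm f_inj)^-1 j)%g ((perm f_inj)^-1 i)%g.
    by rewrite /before; case: ifP => // _; apply: ltnW.
  by have := position_mono (ltn_ord _) bji; rewrite !fK ltnNge ij.
Qed.

Lemma sort_into_run s x y z : nats s in_size 0 = m ->
  uniq [:: y; z; in_size; loop1; loop2; counter; keys; ranks; listed] ->
  x \notin [:: loop1; keys] ->
  exists p : {perm 'I_m},
    [/\ forall i : 'I_m, nats (run (sort_into x y z) s) y i = (p^-1)%g i,
        forall i : 'I_m, nats (run (sort_into x y z) s) z i = p i &
        forall i j : 'I_m, (i <= j)%N ->
          (nats s x ((p^-1)%g i) <= nats s x ((p^-1)%g j))%N].
Proof.
move=> sm /=; rewrite !inE !negb_or.
case/andP=> /and5P[yz y0 y1 y2 /and4P[yc yk yr yo]].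
case/andP=> /and5P[z0 z1 z2 zc /and3P[zk zr zo]] _.
case/andP=> x1 xk.
rewrite /sort_into !run_seq.
set s1 := run (copy x keys) s; have s1m : nats s1 in_size 0 = m by rewrite run_nats.
have [p [pr po pk]] := sort_perm s1m; exists p.
set s2 := run counting_sort s1 in pr po *.
have s2m : nats s2 in_size 0 = m by rewrite run_nats.
have s3m : nats (run (copy listed y) s2) in_size 0 = m.
  by rewrite run_nats // !inE negb_or [in_size == y]eq_sym y0.
split=> [i|i|i j ij].
- rewrite run_nats; last by rewrite !inE negb_or y1.
  by rewrite copy_run // eq_sym.
- rewrite copy_run //; last by rewrite eq_sym.
  by rewrite run_nats // !inE negb_or [ranks == y]eq_sym yr.
- by have := pk i j ij; rewrite !copy_run.
Qed.

End Procedures.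


(** * The elimination procedure *)

Definition el_D := 20%N.
Definition el_R := 21%N.
Definition el_S := 22%N.
Definition el_T := 23%N.
Definition el_M := 24%N.
Definition scalar := 25%N.
Definition used := 38%N.

Definition identity x : program :=
  Seq (fill x KZero) (loop loop1 (KSet x (var loop1) (var loop1) KOne)).

Definition search_pivot : program :=
  loop loop2
    (If (TEqn (IGet used (var loop2)) (ICst 0))
      (If (TIsZero (KGet el_R (var row_reg) (var loop2))) Skip
        (If (TEqn (var found) (ICst 0))
          (Seq (ISet found (ICst 0) (ICst 1))
               (ISet col_reg (ICst 0) (var loop2)))
          Skip))
      Skip).

Definition record_pivot : program :=
  Seq (KSet el_M (var row_reg) (var col_reg)
        (KGet el_R (var row_reg) (var col_reg)))
      (loop loop3
        (KSet el_T (var loop3) (var row_reg)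
          (KDiv (KGet el_R (var loop3) (var col_reg))
                (KGet el_R (var row_reg) (var col_reg))))).

Definition subtract_pivot x : program :=
  KSet x (var loop3) (var loop2)
    (KSub (KGet x (var loop3) (var loop2))
      (KMul (KGet scalar (ICst 0) (ICst 0)) (KGet x (var loop3) (var col_reg)))).

Definition subtract_columns : program :=
  loop loop2
    (If (TLeq (IAdd (var col_reg) (ICst 1)) (var loop2))
      (If (TEqn (IGet used (var loop2)) (ICst 0))
        (Seq (KSet scalar (ICst 0) (ICst 0)
               (KDiv (KGet el_R (var row_reg) (var loop2))
                     (KGet el_R (var row_reg) (var col_reg))))
             (loop loop3 (Seq (subtract_pivot el_R) (subtract_pivot el_S))))
        Skip)
      Skip).

Definition process_row : program :=
  Seq (ISet row_reg (ICst 0) (ISub cell_count (IAdd (var loop1) (ICst 1))))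
 (Seq (ISet found (ICst 0) (ICst 0))
 (Seq search_pivot
      (If (TEqn (var found) (ICst 1))
        (Seq record_pivot
        (Seq subtract_columns
             (ISet used (var col_reg) (ICst 1))))
        Skip))).

(** Clears the rows from the last one up; the state after v rows is the one of
    the record eliminated. *)
Definition elimination : program :=
  Seq (fill el_R (entry el_D))
 (Seq (identity el_S) (Seq (identity el_T) (Seq (fill el_M KZero)
 (Seq (loop loop1 (ISet used (var loop1) (ICst 0)))
      (loop loop1 process_row))))).

Section EliminationRun.
Variables (K : fieldType) (m : nat).
Implicit Type s : memory K.

Lemma mx_run p s x : x \notin elt_writes p -> mx m (run p s) x = mx m s x.
Proof. by move=> xp; apply/matrixP => i j; rewrite !mxE run_elts. Qed.

Lemma identity_run s x : nats s in_size 0 = m -> mx m (run (identity x) s) x = 1%:M.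
Proof.
move=> sm; rewrite run_seq; set s1 := run (fill x KZero) s.
have s1m : nats s1 in_size 0 = m by rewrite run_nats.
have s1E (i j : 'I_m) : elts s1 x i j = 0.
  have -> : elts s1 x i j = mx m s1 x i j by rewrite mxE.
  by rewrite (fill_run (A := 0)) ?mxE // => *; rewrite mxE.
pose I v s' := forall i j : 'I_m,
  elts s' x i j = ((i == j) && (i < v)%N)%:R.
suff H : I m (run (loop loop1 (KSet x (var loop1) (var loop1) KOne)) s1).
  by apply/matrixP => i j; rewrite !mxE H ltn_ord andbT.
apply: (loop_ind (I := I) s1m) => [i j|v s' vm _ _ IH i j].
  by rewrite ltn0 andbF s1E.
rewrite /= eqxx IH ltnS [(i <= v)%N]leq_eqVlt /= -val_eqE /=.
case: (eqVneq (i : nat) v) => [->|iv] //=.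
by case: (eqVneq (j : nat) v) => _; rewrite ?ltnn ?andbT ?andbF //= ltnSn.
Qed.

Lemma search_run s (i : 'I_m) : nats s in_size 0 = m ->
  nats s row_reg 0 = i -> nats s found 0 = 0%N ->
  let s' := run search_pivot s in
  (nats s' found 0 = 0%N /\
   forall l : 'I_m, nats s used l = 0%N -> mx m s el_R i l = 0) \/
  (exists j : 'I_m,
    [/\ nats s' found 0 = 1%N, nats s' col_reg 0 = j, nats s used j = 0%N,
        mx m s el_R i j != 0 &
        forall l : 'I_m, (l < j)%N -> nats s used l = 0%N -> mx m s el_R i l = 0]).
Proof.
move=> sm si s0 /=.
pose I v s' :=
  (nats s' found 0 = 0%N /\
   forall l : 'I_m, (l < v)%N -> nats s used l = 0%N -> mx m s el_R i l = 0) \/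
  (exists j : 'I_m,
    [/\ nats s' found 0 = 1%N, nats s' col_reg 0 = j, nats s used j = 0%N,
        mx m s el_R i j != 0 &
        forall l : 'I_m, (l < j)%N -> nats s used l = 0%N -> mx m s el_R i l = 0]).
have : I m (run search_pivot s).
  apply: (loop_ind (I := I) sm) => [|v s' vm frn fre]; first by left.
  pose o := Ordinal vm.
  have oE : elts s el_R i v = mx m s el_R i o by rewrite mxE.
  case=> [[f0 left0]|[j [f1 sj uj Rij left0]]]; step; last first.
    right; exists j.
    by case: ifP => _; step => //; case: ifP => _; step => //; rewrite f1.
  case: ifP => [/eqP us|us]; step; last first.
    left; split=> // l; rewrite ltnS leq_eqVlt.
    case/predU1P => [-> /eqP|]; last exact: left0.
    by rewrite us.
  rewrite si oE; case: eqP => [R0|/eqP R0]; step.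
    left; split=> // l; rewrite ltnS leq_eqVlt => /predU1P[lv _|]; last exact: left0.
    by rewrite (_ : l = o) //; apply/val_inj.
  rewrite f0; step; right; exists o; split=> //= l lv; exact: left0.
case=> [[f0 left0]|]; [left; split=> // l; exact: left0 | by right].
Qed.

Lemma record_run s (i j : 'I_m) : nats s in_size 0 = m ->
  nats s row_reg 0 = i -> nats s col_reg 0 = j ->
  let s' := run record_pivot s in let R := mx m s el_R in
  (forall r l, mx m s' el_M r l =
     if (r == i) && (l == j) then R i j else mx m s el_M r l) /\
  (forall r l, mx m s' el_T r l =
     if l == i then R r j / R i j else mx m s el_T r l).
Proof.
move=> sm si sj /=; rewrite run_seq.
set s1 := run (KSet _ _ _ _) s.
have s1m : nats s1 in_size 0 = m by [].
split=> r l.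
  by rewrite !mxE run_elts //= si sj -!val_eqE.
pose I v s' := forall r l : 'I_m, elts s' el_T r l =
  if (l == i) && (r < v)%N then mx m s el_R r j / mx m s el_R i j
  else elts s el_T r l.
suff H : I m (run (loop loop3 (KSet el_T (var loop3) (var row_reg)
          (KDiv (KGet el_R (var loop3) (var col_reg))
                (KGet el_R (var row_reg) (var col_reg))))) s1).
  by rewrite [LHS]mxE H ltn_ord andbT; congr (if _ then _ else _); rewrite mxE.
apply: (loop_ind (I := I) s1m) => [a b|v s' vm frn fre IH a b].
  by rewrite ltn0 andbF.
step; rewrite si sj IH ltnS [(a <= v)%N]leq_eqVlt !mxE -val_eqE.
case: (eqVneq (a : nat) v) => [->|av] //=.
by case: eqP => _; rewrite //= ltnn.
Qed.

Lemma subtract_columns_run s (i j : 'I_m) : nats s in_size 0 = m ->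
  nats s row_reg 0 = i -> nats s col_reg 0 = j ->
  let s' := run subtract_columns s in let R := mx m s el_R in
  let c := factor R (fun l => nats s used l != 0%N) i j in
  (forall r l, mx m s' el_R r l = R r l - c l * R r j) /\
  (forall r l, mx m s' el_S r l = mx m s el_S r l - c l * mx m s el_S r j).
Proof.
move=> sm si sj s' R c.
pose upd x (b : bool) (r l : 'I_m) :=
  if b then mx m s x r l - c l * mx m s x r j else mx m s x r l.
pose I v s' := forall r l : 'I_m,
  elts s' el_R r l = upd el_R (l < v)%N r l /\
  elts s' el_S r l = upd el_S (l < v)%N r l.
suff H : I m s'.
  split=> r l; rewrite mxE; have [Hr Hs] := H r l.
    by rewrite Hr /upd ltn_ord.
  by rewrite Hs /upd ltn_ord.
apply: (loop_ind (I := I) sm) => [r l|v s1 vm frn fre IH].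
  by rewrite /upd ltn0 !mxE.
pose o := Ordinal vm.
have skip : c o = 0 -> I v.+1 (set_nat s1 loop2 0 v).
  move=> c0 r l; have [Hr Hs] := IH r l.
  rewrite /= Hr Hs /upd ltnS [(l <= v)%N]leq_eqVlt.
  case: eqP => //= lv; rewrite (_ : l = o); last by apply/val_inj.
  by rewrite c0 !mul0r !subr0 !if_same.
step; rewrite sj addn1; case: (ltnP j v) => jv; step; last first.
  by apply: skip; rewrite /c /factor /= ltnNge jv andbF.
case: (eqVneq (nats s used v) 0%N) => us; step; last first.
  by apply: skip; rewrite /c /factor /= us.
have cj : c j = 0 by rewrite /c /factor ltnn andbF.
have updj x b r : upd x b r j = mx m s x r j.
  by rewrite /upd cj mul0r subr0 if_same.
have co : c o = elts s1 el_R i v / elts s1 el_R i j.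
  have [-> _] := IH i o; have [-> _] := IH i j.
  by rewrite updj /upd ltnn /c /factor /= us jv.
set s2 := run (KSet _ _ _ _) _.
have s2m : nats s2 in_size 0 = m by step.
(* During the pass over column v the pivot column keeps its entries, because
   its own factor vanishes. *)
pose J w s' := forall r l : 'I_m,
  elts s' el_R r l = upd el_R ((l < v) || (l == o) && (r < w))%N r l /\
  elts s' el_S r l = upd el_S ((l < v) || (l == o) && (r < w))%N r l.
suff H : J m (run (loop loop3 (Seq (subtract_pivot el_R) (subtract_pivot el_S))) s2).
  by move=> r l; have := H r l; rewrite ltn_ord andbT orbC -leq_eqVlt.
apply: (loop_ind (I := J) s2m) => [r l|w s3 wm frn3 fre3 IH3 r l].
  by rewrite ltn0 andbF orbF; have [<- <-] := IH r l.
pose a := Ordinal wm.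
have [] := IH3 a o; have [] := IH3 a j; have [Rrl Srl] := IH3 r l.
rewrite !updj /= !ltnn /= andbF /upd => Raj Saj Rao Sao.
step; rewrite !(si, sj) -co Raj Saj Rao Sao Rrl Srl /upd -[l == o]val_eqE /=.
rewrite ltnS [(r <= w)%N]leq_eqVlt.
case: (eqVneq (r : nat) w) => [rw|] //=; case: (eqVneq (l : nat) v) => [lv|] //=.
have -> : r = a by apply/val_inj.
have -> : l = o by apply/val_inj.
by rewrite orbT.
Qed.

Lemma process_row_run D s v : nats s in_size 0 = m -> (v < m)%N ->
  let state s := eliminated D v (mx m s el_R) (mx m s el_S) (mx m s el_T)
    (mx m s el_M) (fun l => nats s used l != 0%N) in
  let state' s := eliminated D v.+1 (mx m s el_R) (mx m s el_S) (mx m s el_T)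
    (mx m s el_M) (fun l => nats s used l != 0%N) in
  nats s loop1 0 = v -> state s -> state' (run process_row s).
Proof.
move=> sm vm state state' sv st; rewrite /process_row !run_seq.
set s1 := run (ISet found _ _) _.
have im : (m - v.+1 < m)%N by lia.
pose i := Ordinal im.
have iv : (i + v.+1 = m)%N by rewrite /= subnK.
have s1m : nats s1 in_size 0 = m by [].
have s1i : nats s1 row_reg 0 = i by rewrite /= sm sv addn1.
have [] := search_run s1m s1i erefl; set s2 := run search_pivot s1.
  case=> f0 R0; rewrite run_if /= f0 /= /state' !mx_run //.
  have u_eq : (fun l : 'I_m => nats s used l != 0%N) =1
              (fun l : 'I_m => nats s2 used l != 0%N).
    by move=> l; rewrite run_nats.
  apply: eq_eliminated u_eq _; apply: eliminated_skip iv _ st => l ul.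
  by apply: R0; apply/eqP; rewrite -[_ == _]negbK.
case=> j [f1 s2j uj Rij left_j].
rewrite run_if /= f1 /= run_seq run_seq.
have s2m : nats s2 in_size 0 = m by rewrite run_nats.
have s2i : nats s2 row_reg 0 = i by rewrite run_nats.
have [M_eq T_eq] := record_run s2m s2i s2j.
set s3 := run record_pivot s2 in M_eq T_eq *.
have s3m : nats s3 in_size 0 = m by rewrite run_nats.
have s3i : nats s3 row_reg 0 = i by rewrite run_nats.
have s3j : nats s3 col_reg 0 = j by rewrite run_nats.
have [R_eq S_eq] := subtract_columns_run s3m s3i s3j.
set s4 := run subtract_columns s3 in R_eq S_eq *.
have us l : nats s3 used l = nats s used l by rewrite !run_nats.
have fE l : factor (mx m s3 el_R) (fun l => nats s3 used l != 0%N) i j l =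
            factor (mx m s el_R) (fun l => nats s used l != 0%N) i j l.
  by rewrite /factor !mx_run // us.
apply: eliminated_pivot iv _ _ _ _ _ _ _ _ st.
- by apply: (_ : ~~ (nats s used j != 0%N)); apply/negPn/eqP.
- exact: Rij.
- by move=> l lj; rewrite negbK => /eqP ul; apply: left_j.
- by move=> r l; rewrite mx_run // R_eq fE !mx_run.
- by move=> r l; rewrite mx_run // S_eq fE !mx_run.
- by move=> r l; rewrite mx_run // mx_run // T_eq !mx_run.
- by move=> r l; rewrite mx_run // mx_run // M_eq !mx_run.
- move=> l /=; rewrite run_nats // s3j run_nats // us -val_eqE /=.
  by case: (_ == nat_of_ord j); rewrite ?orbT ?orbF.
Qed.

Lemma elimination_run s : nats s in_size 0 = m ->
  let s' := run elimination s in
  umatch (mx m s' el_T) (mx m s' el_M) (mx m s el_D) (mx m s' el_S).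
Proof.
move=> sm s'; rewrite /s' /elimination; do 5!rewrite run_seq.
set s1 := run (fill el_R _) s; have s1m : nats s1 in_size 0 = m by rewrite run_nats.
set s2 := run (identity el_S) s1.
have s2m : nats s2 in_size 0 = m by rewrite run_nats.
set s3 := run (identity el_T) s2.
have s3m : nats s3 in_size 0 = m by rewrite run_nats.
set s4 := run (fill el_M _) s3; have s4m : nats s4 in_size 0 = m by rewrite run_nats.
set s5 := run (loop _ (ISet _ _ _)) s4.
have s5m : nats s5 in_size 0 = m by rewrite run_nats.
have u0 (l : 'I_m) : nats s5 used l = 0%N.
  pose I v s' := forall l : 'I_m, (l < v)%N -> nats s' used l = 0%N.
  suff H : I m s5 by apply: H.
  apply: (loop_ind (I := I) s4m) => // v s6 vm _ _ IH k; rewrite ltnS leq_eqVlt /=.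
  by case: eqP => //= _; apply: IH.
have R0 : mx m s5 el_R = mx m s el_D.
  rewrite mx_run // mx_run // mx_run // mx_run //.
  apply: fill_run => // s6 i j frn fre _ i_eq j_eq; rewrite /= i_eq j_eq.
  by rewrite fre // mxE.
have S0 : mx m s5 el_S = 1%:M by rewrite mx_run // mx_run // mx_run // identity_run.
have T0 : mx m s5 el_T = 1%:M by rewrite mx_run // mx_run // identity_run.
have M0 : mx m s5 el_M = 0.
  by rewrite mx_run //; apply: fill_run => // *; rewrite mxE.
pose I v s := eliminated (mx m s5 el_R) v (mx m s el_R) (mx m s el_S) (mx m s el_T)
    (mx m s el_M) (fun l => nats s used l != 0%N).
rewrite -R0; suff : I m (run (loop loop1 process_row) s5) by exact: eliminated_umatch.
apply: (loop_ind (I := I) s5m) => [|v s6 vm frn fre IH].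
  rewrite /I S0 T0 M0; apply: eq_eliminated (eliminated0 _) => l.
  by rewrite u0.
apply: process_row_run => //=; first by unwritten.
Qed.

End EliminationRun.

(** * The phases of the algorithm *)

Definition rank_sigma := 33%N.
Definition rank_tau := 34%N.
Definition ker_keys := 36%N.
Definition im_keys := 37%N.
Definition spare := 39%N.
Definition solution := 26%N.
Definition off_diagonal := 27%N.
Definition product := 28%N.

Definition umatch_into e t mm sg : program :=
  Seq (fill el_D e) (Seq elimination
  (Seq (fill t (entry el_T)) (Seq (fill mm (entry el_M)) (fill sg (entry el_S))))).

Definition boundary_matrix : program :=
  fill out_D (KGet in_boundary (IGet out_tau (var loop1))
                               (IGet out_sigma (var loop2))).

Definition ker_scan : program :=
  loop loop2
    (If (TIsZero (KGet out_M (var loop2) (IGet rank_sigma (var loop1)))) Skip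
    (If (TLeq (IGet ker_keys (var loop1))
              (IGet in_birthG (IGet out_tau (var loop2))))
        (ISet ker_keys (var loop1) (IGet in_birthG (IGet out_tau (var loop2))))
        Skip)).

Definition ker_lookups : program :=
  loop loop1
    (Seq (ISet ker_keys (var loop1) (IGet in_birthF (var loop1))) ker_scan).

Definition im_scan : program :=
  loop loop2
    (If (TIsZero (KGet out_M (IGet rank_tau (var loop1)) (var loop2))) Skip
    (If (TLeq (IGet in_birthF (IGet out_sigma (var loop2)))
              (IGet im_keys (var loop1)))
        (ISet im_keys (var loop1) (IGet in_birthF (IGet out_sigma (var loop2))))
        Skip)).

Definition im_lookups : program :=
  loop loop1
    (Seq (ISet im_keys (var loop1) (IGet in_birthG (var loop1))) im_scan).

Definition matrix_A : program :=
  fill out_A (KGet out_T (var loop1) (IGet rank_tau (IGet out_beta (var loop2)))).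

Definition matrix_B : program :=
  fill out_B (KGet out_S (IGet rank_sigma (IGet out_tau (var loop1)))
                         (IGet rank_sigma (IGet out_gamma (var loop2)))).

Definition substitute_row : program :=
  fill solution (KSub (entry solution)
    (KMul (KGet off_diagonal (var loop1) (var row_reg))
          (KGet el_R (var row_reg) (var loop2)))).

(** Solves T Y = B for a unitriangular T: starting from Y = B and from the last
    row, each row of Y is final when its multiples by the entries of T above
    the diagonal are subtracted from the rows above it.  The copy of Y is needed
    because a row is read while the matrix is being rewritten. *)
Definition back_substitution : program :=
  Seq (fill solution (entry out_B))
 (Seq (identity off_diagonal)
 (Seq (fill off_diagonal (KSub (entry out_T) (entry off_diagonal)))
      (loop loop3
        (Seq (ISet row_reg (ICst 0) (ISub cell_count (IAdd (var loop3) (ICst 1))))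
        (Seq (fill el_R (entry solution)) substitute_row))))).

Definition representatives : program :=
  Seq (fill product KZero)
      (loop loop3
        (fill product (KAdd (entry product)
          (KMul (KGet out_A (var loop1) (var loop3))
                (KGet out_T' (var loop3) (var loop2)))))).

Definition append_bar : program :=
  Seq (ISet out_ker (var out_size) (IGet ker_keys (IGet out_gamma (var loop2))))
 (Seq (ISet out_im (var out_size) (IGet im_keys (IGet out_beta (var loop1))))
 (Seq (loop loop3
        (KSet out_chain (var out_size) (var loop3)
           (KGet product (IGet rank_tau (var loop3)) (var loop1))))
      (ISet out_size (ICst 0) (IAdd (var out_size) (ICst 1))))).

Definition write_row : program :=
  loop loop2
    (If (TIsZero (KGet out_M' (var loop1) (var loop2))) Skip
    (If (TEqn (IGet ker_keys (IGet out_gamma (var loop2)))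
              (IGet im_keys (IGet out_beta (var loop1)))) Skip
        append_bar)).

Definition write_output : program :=
  Seq (ISet out_size (ICst 0) (ICst 0)) (loop loop1 write_row).

Section Phases.
Variables (K : fieldType) (m : nat).
Implicit Type s : memory K.
Local Notation mx := (mx m).

Lemma mxE' s x (i j : 'I_m) : elts s x i j = mx s x i j.
Proof. by rewrite mxE. Qed.

Lemma entry_val s s' x (i j : 'I_m) :
  nats s' loop1 0 = i -> nats s' loop2 0 = j ->
  elts s' x i j = elts s x i j -> kval s' (entry x) = mx s x i j.
Proof. by move=> si sj e; rewrite /= si sj e mxE. Qed.

Lemma copy_matrix s x y : nats s in_size 0 = m -> x != y ->
  mx (run (fill y (entry x)) s) y = mx s x.
Proof.
move=> sm xy; apply: fill_run => // s' i j _ fre _ si sj.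
by apply: entry_val; rewrite ?fre.
Qed.

Lemma umatch_into_run s e t mm sg (A : 'M[K]_m) : nats s in_size 0 = m ->
  uniq [:: t; mm; sg; el_T; el_M; el_S] ->
  mx (run (fill el_D e) s) el_D = A ->
  let s' := run (umatch_into e t mm sg) s in
  umatch (mx s' t) (mx s' mm) A (mx s' sg).
Proof.
move=> sm; rewrite /= !inE !negb_or.
case/and4P=> /and5P[tm tsg tT tM tS] /and4P[msg mT mM mS] /and3P[gT gM gS] _ AE.
rewrite /umatch_into; do 4!rewrite run_seq.
set s1 := run (fill el_D e) s in AE *.
have s1m : nats s1 in_size 0 = m by rewrite run_nats.
set s2 := run elimination s1; have s2m : nats s2 in_size 0 = m by rewrite run_nats.
set s3 := run (fill t _) s2; have s3m : nats s3 in_size 0 = m by rewrite run_nats.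
set s4 := run (fill mm _) s3; have s4m : nats s4 in_size 0 = m by rewrite run_nats.
set s5 := run (fill sg _) s4.
have -> : mx s5 t = mx s2 el_T.
  rewrite mx_run /= ?inE // mx_run /= ?inE // copy_matrix // eq_sym //.
have -> : mx s5 mm = mx s2 el_M.
  rewrite mx_run /= ?inE // copy_matrix 1?eq_sym // mx_run //= inE eq_sym //.
have -> : mx s5 sg = mx s2 el_S.
  rewrite copy_matrix 1?eq_sym // mx_run /= ?inE 1?eq_sym //.
  by rewrite mx_run /= ?inE 1?eq_sym.
rewrite -AE; exact: elimination_run.
Qed.

Lemma back_substitution_run s : nats s in_size 0 = m ->
  upper_unitriangular (mx s out_T) ->
  mx s out_T *m mx (run back_substitution s) solution = mx s out_B.
Proof.
move=> sm [T1 T0]; rewrite /back_substitution; do 3!rewrite run_seq.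
set s1 := run (fill solution _) s.
have s1m : nats s1 in_size 0 = m by rewrite run_nats.
set s2 := run (identity _) s1; have s2m : nats s2 in_size 0 = m by rewrite run_nats.
set s3 := run (fill off_diagonal _) s2.
have s3m : nats s3 in_size 0 = m by rewrite run_nats.
have Y0 : mx s3 solution = mx s out_B.
  by rewrite mx_run // mx_run // copy_matrix.
have UE : mx s3 off_diagonal = mx s out_T - 1%:M.
  apply: fill_run => // s' i j frn fre old si sj.
  rewrite /= si sj old fre // !mxE' identity_run // !mx_run //.
  by rewrite [in RHS]mxE [X in _ = _ + X]mxE.
move: (mx s out_T) T1 T0 UE => T T1 T0 UE.
(* Rows of index at least m - v are final. *)
pose I v s' := forall i c : 'I_m, mx s out_B i c = mx s' solution i c +
  \sum_(k < m | (m <= k + v)%N) mx s3 off_diagonal i k * mx s' solution k c.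
set s4 := run _ s3; suff H : I m s4.
  apply/matrixP => i c; rewrite H UE [LHS]mxE.
  rewrite [in RHS](eq_bigl predT) => [|k]; last by rewrite leq_addl.
  rewrite (bigD1 i) //= T1 mul1r [in RHS](bigD1 i) //=.
  rewrite [(T - _) i i]mxE T1 !mxE eqxx subrr mul0r add0r; congr (_ + _).
  by apply: eq_bigr => k ki; rewrite !mxE eq_sym (negPf ki) subr0.
apply: (loop_ind (I := I) s3m) => [i c|v s5 vm frn fre IH i c].
  by rewrite Y0 big1 ?addr0 // => k; rewrite addn0 leqNgt ltn_ord.
have km : (m - v.+1 < m)%N by lia.
pose k := Ordinal km.
have kv : (k + v.+1 = m)%N by rewrite /= subnK.
do 2!rewrite run_seq.
set s6 := run (ISet _ _ _) _; have s6m : nats s6 in_size 0 = m by step.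
have s6k : nats s6 row_reg 0 = k by step; rewrite s3m addn1.
set s7 := run (fill el_R _) s6; have s7m : nats s7 in_size 0 = m by rewrite run_nats.
have -> : mx (run substitute_row s7) solution = \matrix_(i, c)
    (mx s5 solution i c - mx s3 off_diagonal i k * mx s5 solution k c).
  apply: fill_run => // s8 a b frn8 fre8 old sa sb.
  rewrite /= sa sb frn8 // old !fre8 // [nats s7 _ _]run_nats // s6k !mxE'.
  rewrite [mx s7 el_R]copy_matrix // ![mx s7 _]mx_run // [RHS]mxE; congr (_ - _ * _).
  by rewrite !mxE fre.
rewrite IH [X in _ = X + _]mxE -addrA; congr (_ + _).
have U0 (a : 'I_m) : (k <= a)%N -> mx s3 off_diagonal a k = 0.
  rewrite UE !mxE leq_eqVlt => /predU1P[/val_inj->|ka].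
    by rewrite T1 eqxx subrr.
  by rewrite T0 // -val_eqE /= gtn_eqF // subrr.
rewrite [in RHS](bigD1 k) /=; last by rewrite kv.
rewrite [X in _ * X + _]mxE (U0 k) // mul0r subr0 addrA addNr add0r.
apply: eq_big => [a|a ma].
  by rewrite -val_eqE /=; lia.
by rewrite [X in _ = _ * X]mxE (U0 a) ?mul0r ?subr0 //; lia.
Qed.

Lemma representatives_run s : nats s in_size 0 = m ->
  mx (run representatives s) product = mx s out_A *m mx s out_T'.
Proof.
move=> sm; rewrite /representatives run_seq.
set s1 := run (fill _ _) s; have s1m : nats s1 in_size 0 = m by rewrite run_nats.
pose I v s' := forall i j : 'I_m, mx s' product i j =
  \sum_(0 <= k < v) elts s out_A i k * elts s out_T' k j.
set s2 := run _ s1; suff H : I m s2.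
  apply/matrixP => i j; rewrite H big_mkord mxE; apply: eq_bigr => k _.
  by rewrite !mxE'.
apply: (loop_ind (I := I) s1m) => [i j|v s3 vm frn fre IH i j].
  by rewrite big_nil (fill_run (A := 0)) ?mxE // => *; rewrite mxE.
set s4 := set_nat _ _ _ _; have s4m : nats s4 in_size 0 = m by step.
rewrite (fill_run (A := \matrix_(i, j)
  (mx s3 product i j + elts s out_A i v * elts s out_T' v j))) //.
  by rewrite mxE IH big_nat_recr.
move=> s5 a b frn5 fre5 old sa sb.
rewrite /= sa sb frn5 // old !fre5 //= [RHS]mxE mxE.
by congr (_ + _ * _); rewrite fre // run_elts.
Qed.

End Phases.

Section Lookups.
Variables (K : fieldType) (m : nat).
Implicit Type s : memory K.

Lemma all_iotaS (P : pred nat) w : all P (iota 0 w.+1) = all P (iota 0 w) && P w.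
Proof. by rewrite -addn1 iotaD all_cat /= andbT. Qed.

(** The loops compute a maximum and a minimum, which are characterized by
    their upper and lower bounds respectively. *)
Lemma ker_lookups_run s t a : nats s in_size 0 = m -> (a < m)%N ->
  (nats (run ker_lookups s) ker_keys a <= t)%N =
  (nats s in_birthF a <= t)%N &&
  all (fun j => (elts s out_M j (nats s rank_sigma a) != 0) ==>
                (nats s in_birthG (nats s out_tau j) <= t)%N) (iota 0 m).
Proof.
move=> sm am.
pose I w a s' := (nats s' ker_keys a <= t)%N = (nats s in_birthF a <= t)%N &&
  all (fun j => (elts s out_M j (nats s rank_sigma a) != 0) ==>
                (nats s in_birthG (nats s out_tau j) <= t)%N) (iota 0 w).
pose J v s' := forall a, (a < v)%N -> I m a s'.
suff H : J m (run ker_lookups s) by apply: H.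
apply: (loop_ind (I := J) sm) => // v s1 vm frn fre IH; rewrite run_seq.
set s2 := run _ (set_nat _ _ _ _); have s2m : nats s2 in_size 0 = m by step.
pose L w s' := I w v s' /\ forall b, (b < v)%N -> I m b s'.
suff [Hv Hb] : L m (run ker_scan s2).
  by move=> b; rewrite ltnS leq_eqVlt => /predU1P[->|]; last exact: Hb.
apply: (loop_ind (I := L) s2m) => [|w s3 wm frn3 fre3 [Hv Hb]].
  split=> [|b bv]; rewrite /I /=; first by step; rewrite eqxx andbT.
  by step; rewrite ltn_eqF //; apply: IH.
step; rewrite /L /I all_iotaS; case: eqP => Mw /=; step.
  by rewrite /= andbT; split.
case: (leqP (nats s3 ker_keys v) (nats s in_birthG (nats s out_tau w))) => kw;
  step; last first.
  rewrite andbA -Hv; split=> //; apply/idP/andP => [kt|[]//]; split=> //.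
  exact: ltnW (leq_trans kw kt).
split=> [|b bv]; last by rewrite ltn_eqF //; apply: Hb.
rewrite eqxx andbA -Hv; apply/idP/andP => [kt|[]//]; split=> //.
exact: leq_trans kw kt.
Qed.

Lemma im_lookups_run s t a : nats s in_size 0 = m -> (a < m)%N ->
  (t <= nats (run im_lookups s) im_keys a)%N =
  (t <= nats s in_birthG a)%N &&
  all (fun j => (elts s out_M (nats s rank_tau a) j != 0) ==>
                (t <= nats s in_birthF (nats s out_sigma j))%N) (iota 0 m).
Proof.
move=> sm am.
pose I w a s' := (t <= nats s' im_keys a)%N = (t <= nats s in_birthG a)%N &&
  all (fun j => (elts s out_M (nats s rank_tau a) j != 0) ==>
                (t <= nats s in_birthF (nats s out_sigma j))%N) (iota 0 w).
pose J v s' := forall a, (a < v)%N -> I m a s'.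
suff H : J m (run im_lookups s) by apply: H.
apply: (loop_ind (I := J) sm) => // v s1 vm frn fre IH; rewrite run_seq.
set s2 := run _ (set_nat _ _ _ _); have s2m : nats s2 in_size 0 = m by step.
pose L w s' := I w v s' /\ forall b, (b < v)%N -> I m b s'.
suff [Hv Hb] : L m (run im_scan s2).
  by move=> b; rewrite ltnS leq_eqVlt => /predU1P[->|]; last exact: Hb.
apply: (loop_ind (I := L) s2m) => [|w s3 wm frn3 fre3 [Hv Hb]].
  split=> [|b bv]; rewrite /I /=; first by step; rewrite eqxx andbT.
  by step; rewrite ltn_eqF //; apply: IH.
step; rewrite /L /I all_iotaS; case: eqP => Mw /=; step.
  by rewrite /= andbT; split.
case: (leqP (nats s in_birthF (nats s out_sigma w)) (nats s3 im_keys v)) => kw;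
  step; last first.
  rewrite andbA -Hv; split=> //; apply/idP/andP => [kt|[]//]; split=> //.
  exact: ltnW (leq_ltn_trans kt kw).
split=> [|b bv]; last by rewrite ltn_eqF //; apply: Hb.
rewrite eqxx andbA -Hv; apply/idP/andP => [kt|[]//]; split=> //.
exact: leq_trans kt kw.
Qed.

(** The pairs of indices processed before (v, w) in row-major order. *)
Definition precedes v w (x : 'I_m * 'I_m) : bool :=
  (x.1 < v)%N || (x.1 == v :> nat) && (x.2 < w)%N.

(** The list L consists of the pairs of indices of the nonzero entries of M'
    with distinct endpoints, in the order in which the bars are written. *)
Lemma write_output_run s : nats s in_size 0 = m ->
  let s' := run write_output s in
  let ker j := nats s ker_keys (nats s out_gamma j) in
  let im i := nats s im_keys (nats s out_beta i) in
  exists L : seq ('I_m * 'I_m),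
    [/\ uniq L,
        forall x, (x \in L) = (elts s out_M' x.1 x.2 != 0) && (ker x.2 != im x.1),
        nats s' out_size 0 = size L &
        forall k x0, (k < size L)%N ->
          [/\ nats s' out_ker k = ker (nth x0 L k).2,
              nats s' out_im k = im (nth x0 L k).1 &
              forall i : 'I_m, elts s' out_chain k i =
                elts s product (nats s rank_tau i) (nth x0 L k).1]].
Proof.
move=> sm s' ker im.
pose I v w s' := exists L : seq ('I_m * 'I_m),
    [/\ uniq L,
        forall x, (x \in L) = [&& elts s out_M' x.1 x.2 != 0, ker x.2 != im x.1
                                & precedes v w x],
        nats s' out_size 0 = size L &
        forall k x0, (k < size L)%N ->
          [/\ nats s' out_ker k = ker (nth x0 L k).2,
              nats s' out_im k = im (nth x0 L k).1 &
              forall i : 'I_m, elts s' out_chain k i =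
                elts s product (nats s rank_tau i) (nth x0 L k).1]].
suff [L [uL memL szL nthL]] : I m 0%N s'.
  by exists L; split=> // x; rewrite memL /precedes ltn_ord !andbT.
rewrite /s' /write_output run_seq; set s0 := run (ISet _ _ _) s.
have s0m : nats s0 in_size 0 = m by [].
apply: (loop_ind (I := fun v => I v 0%N) s0m) => [|v s1 vm frn fre IH].
  by exists [::]; split=> // x; rewrite /precedes !ltn0 andbF in_nil !andbF.
set s2 := set_nat _ _ _ _; have s2m : nats s2 in_size 0 = m by step.
suff [L [uL memL szL nthL]] : I v m (run write_row s2).
  exists L; split=> // x; rewrite memL /precedes ltn_ord !andbT ltn0 andbF orbF.
  by rewrite ltnS [(x.1 <= v)%N]leq_eqVlt [(x.1 == v :> nat) || _]orbC.
apply: (loop_ind (I := I v) s2m) => [//|w s3 wm frn3 fre3 [L [uL memL szL nthL]]].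
pose a := Ordinal vm; pose b := Ordinal wm.
have precS x : precedes v w.+1 x = (x == (a, b)) || precedes v w x.
  case: x => i j; rewrite /precedes xpair_eqE -!val_eqE /= ltnS [(j <= w)%N]leq_eqVlt.
  by case: (_ < v)%N; case: (_ == v); rewrite ?orbT ?orbF.
have skip : ~~ ((elts s out_M' a b != 0) && (ker b != im a)) ->
  I v w.+1 (set_nat s3 loop2 0 w).
  move=> ne; exists L; split=> // x; rewrite memL precS.
  by case: (x =P (a, b)) => [->|] //; rewrite !andbA (negPf ne).
step; case: eqP => Mw; step; first by apply: skip; rewrite /= Mw eqxx.
case: eqP => kw; step; first by apply: skip; rewrite /ker /im /= kw eqxx andbF.

set s4 := run (ISet out_im _ _) _.
have s4m : nats s4 in_size 0 = m by step.
set s5 := run (loop _ _) s4.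
have s5n y k : y != loop3 -> nats s5 y k = nats s4 y k.
  by move=> y3; rewrite run_nats //= inE.
have s4z : nats s4 out_size 0 = size L by step.
have s5c k (i : 'I_m) : elts s5 out_chain k i =
    if k == size L then elts s product (nats s rank_tau i) v
    else elts s3 out_chain k i.
  pose J u s' := forall k (i : 'I_m), elts s' out_chain k i =
    if (k == size L) && (i < u)%N then elts s product (nats s rank_tau i) v
    else elts s3 out_chain k i.
  suff H : J m s5 by rewrite H ltn_ord andbT.
  apply: (loop_ind (I := J) s4m) => [j i1|u s6 um frn6 fre6 IH6 j i1].
    by rewrite ltn0 andbF.
  step; rewrite szL IH6 ltnS [(i1 <= u)%N]leq_eqVlt.
  case: (eqVneq j (size L)) => //= _; case: (eqVneq (i1 : nat) u) => [->|] //=.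
exists (rcons L (a, b)); split.
- rewrite rcons_uniq uL andbT memL /precedes /= ltnn eqxx ltnn !andbF //.
- move=> x; rewrite mem_rcons inE memL precS; case: (x =P (a, b)) => [->|] //=.
  by rewrite andbT; apply/esym/andP; split; apply/eqP.
- by rewrite size_rcons /= s5n // s4z addn1.
- move=> k x0; rewrite size_rcons ltnS leq_eqVlt nth_rcons => kL.
  rewrite /= !s5n //= szL.
  case/predU1P: kL => [->|kL].
    rewrite ltnn eqxx /=; split; [by step | by step | by move=> i; rewrite s5c eqxx].
  have [nk ni nc] := nthL k x0 kL; rewrite kL !(ltn_eqF kL) /=.
  by split=> // i; rewrite s5c (ltn_eqF kL).
Qed.

End Lookups.

(** * The program and its trace *)

Definition phases : seq program := [::
  sort_into in_birthF out_sigma rank_sigma;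
  sort_into in_birthG out_tau rank_tau;
  boundary_matrix;
  umatch_into (entry out_D) out_T out_M out_S;
  ker_lookups;
  im_lookups;
  sort_into im_keys out_beta spare;
  sort_into ker_keys out_gamma spare;
  matrix_A;
  matrix_B;
  back_substitution;
  umatch_into (KGet solution (IGet rank_tau (IGet out_beta (var loop1)))
                             (var loop2)) out_T' out_M' out_S';
  representatives;
  write_output].

Definition algorithm : program := foldr Seq Skip phases.

(** Transparent, because traces are checked by computing its two functions. *)
Definition relist (T : Type) m (e : listing T m) (p : {perm 'I_m}) : listing T m.
Proof.
exists (fun i => e (p^-1%g i)) (fun x => p (rank e x)).
  by move=> i; rewrite itemK permKV.
by move=> x; rewrite permK rankK.
Defined.

Lemma eq_from_leq x y : (forall t, (x <= t)%N = (y <= t)%N) -> x = y.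
Proof.
by move=> xy; apply/eqP; rewrite eqn_leq [(x <= y)%N]xy -[(y <= x)%N]xy !leqnn.
Qed.

Lemma eq_from_geq x y : (forall t, (t <= x)%N = (t <= y)%N) -> x = y.
Proof.
by move=> xy; apply/eqP; rewrite eqn_leq -[(x <= y)%N]xy [(y <= x)%N]xy !leqnn.
Qed.

Lemma all_iota_ord m (P : pred nat) :
  all P (iota 0 m) = [forall i : 'I_m, P i].
Proof.
apply/allP/forallP => H i; first by apply: H; rewrite mem_iota /=.
by rewrite mem_iota /= => im; have := H (Ordinal im).
Qed.

Section Stages.
Variables (K : fieldType) (m : nat) (s0 : memory K).
Hypothesis s0m : nats s0 in_size 0 = m.

Definition runs (ps : seq program) (s : memory K) : memory K :=
  foldl (fun s' p => run p s') s ps.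

Lemma run_foldr ps s : run (foldr Seq Skip ps) s = runs ps s.
Proof. by elim: ps s => //= p ps IH s; rewrite run_seq IH. Qed.

Lemma runs_nats ps s x i : all (fun p => x \notin nat_writes p) ps ->
  nats (runs ps s) x i = nats s x i.
Proof. by elim: ps s => //= p ps IH s /andP[xp /IH->]; rewrite run_nats. Qed.

Lemma runs_elts ps s x i j : all (fun p => x \notin elt_writes p) ps ->
  elts (runs ps s) x i j = elts s x i j.
Proof. by elim: ps s => //= p ps IH s /andP[xp /IH->]; rewrite run_elts. Qed.

(** Each phase is specified by the memory before and after it.  No later phase
    writes the arrays which its specification mentions, so that it also holds of
    the final memory. *)
Definition after k : memory K := runs (take k phases) s0.
Definition final : memory K := runs phases s0.

Lemma finalE k : final = runs (drop k phases) (after k).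
Proof. by rewrite /after /runs -foldl_cat cat_take_drop. Qed.

Lemma final_nats k x i : all (fun p => x \notin nat_writes p) (drop k phases) ->
  nats (after k) x i = nats final x i.
Proof. by move=> xp; rewrite (finalE k) runs_nats. Qed.

Lemma final_elts k x i j : all (fun p => x \notin elt_writes p) (drop k phases) ->
  elts (after k) x i j = elts final x i j.
Proof. by move=> xp; rewrite (finalE k) runs_elts. Qed.

Lemma final_mx k x : all (fun p => x \notin elt_writes p) (drop k phases) ->
  mx m (after k) x = mx m final x.
Proof. by move=> xp; apply/matrixP => i j; rewrite !mxE final_elts. Qed.

Lemma after_size k : nats (after k) in_size 0 = m.
Proof.
rewrite runs_nats //.
have : all (fun p => in_size \notin nat_writes p) phases by [].
by rewrite -{1}(cat_take_drop k phases) all_cat => /andP[].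
Qed.

Lemma final_sigma : exists p : {perm 'I_m},
  [/\ forall i : 'I_m, nats final out_sigma i = (p^-1)%g i,
      forall i : 'I_m, nats final rank_sigma i = p i &
      forall i j : 'I_m, (i <= j)%N ->
        (nats final in_birthF ((p^-1)%g i) <= nats final in_birthF ((p^-1)%g j))%N].
Proof.
have [//|//|p [pi pr ps]] := @sort_into_run _ _ _ in_birthF out_sigma rank_sigma
  (after_size 0).
exists p; split=> [i|i|i j /ps]; last by rewrite !(@final_nats 0).
  by rewrite -(@final_nats 1).
by rewrite -(@final_nats 1).
Qed.

Lemma final_tau : exists p : {perm 'I_m},
  [/\ forall i : 'I_m, nats final out_tau i = (p^-1)%g i,
      forall i : 'I_m, nats final rank_tau i = p i &
      forall i j : 'I_m, (i <= j)%N ->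
        (nats final in_birthG ((p^-1)%g i) <= nats final in_birthG ((p^-1)%g j))%N].
Proof.
have [//|//|p [pi pr ps]] := @sort_into_run _ _ _ in_birthG out_tau rank_tau
  (after_size 1).
exists p; split=> [i|i|i j /ps]; last by rewrite !(@final_nats 1).
  by rewrite -(@final_nats 2).
by rewrite -(@final_nats 2).
Qed.

Lemma final_beta : exists p : {perm 'I_m},
  (forall i : 'I_m, nats final out_beta i = (p^-1)%g i) /\
  (forall i j : 'I_m, (i <= j)%N ->
     (nats final im_keys ((p^-1)%g i) <= nats final im_keys ((p^-1)%g j))%N).
Proof.
have [//|//|p [pi _ ps]] := @sort_into_run _ _ _ im_keys out_beta spare
  (after_size 6).
by exists p; split=> [i|i j /ps]; rewrite ?(@final_nats 6) // -(@final_nats 7).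
Qed.

Lemma final_gamma : exists p : {perm 'I_m},
  (forall i : 'I_m, nats final out_gamma i = (p^-1)%g i) /\
  (forall i j : 'I_m, (i <= j)%N ->
     (nats final ker_keys ((p^-1)%g i) <= nats final ker_keys ((p^-1)%g j))%N).
Proof.
have [//|//|p [pi _ ps]] := @sort_into_run _ _ _ ker_keys out_gamma spare
  (after_size 7).
by exists p; split=> [i|i j /ps]; rewrite ?(@final_nats 7) // -(@final_nats 8).
Qed.

Lemma final_D : mx m final out_D = \matrix_(i, j)
  elts final in_boundary (nats final out_tau i) (nats final out_sigma j).
Proof.
rewrite -(@final_mx 3) //; apply: (fill_run (after_size 2)).
move=> s i j frn fre _ si sj; rewrite [RHS]mxE [LHS]/= si sj !frn // fre //.
by rewrite !(@final_nats 2) // (@final_elts 2).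
Qed.

Lemma final_umatch : umatch (mx m final out_T) (mx m final out_M)
  (mx m final out_D) (mx m final out_S).
Proof.
rewrite -!(@final_mx 4) //; apply: (umatch_into_run (after_size 3)) => //.
by rewrite (copy_matrix (after_size 3)) // !final_mx.
Qed.

Lemma final_ker_keys (a : 'I_m) t :
  (nats final ker_keys a <= t)%N = (nats final in_birthF a <= t)%N &&
  [forall j : 'I_m, (elts final out_M j (nats final rank_sigma a) != 0) ==>
    (nats final in_birthG (nats final out_tau j) <= t)%N].
Proof.
rewrite -(@final_nats 5) // (ker_lookups_run t (after_size 4)) // all_iota_ord.
rewrite !(@final_nats 4) //; congr (_ && _); apply: eq_forallb => j.
by rewrite !(@final_nats 4) // (@final_elts 4).
Qed.

Lemma final_im_keys (a : 'I_m) t :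
  (t <= nats final im_keys a)%N = (t <= nats final in_birthG a)%N &&
  [forall j : 'I_m, (elts final out_M (nats final rank_tau a) j != 0) ==>
    (t <= nats final in_birthF (nats final out_sigma j))%N].
Proof.
rewrite -(@final_nats 6) // (im_lookups_run t (after_size 5)) // all_iota_ord.
rewrite !(@final_nats 5) //; congr (_ && _); apply: eq_forallb => j.
by rewrite !(@final_nats 5) // (@final_elts 5).
Qed.

Lemma final_A : mx m final out_A = \matrix_(i, j)
  elts final out_T i (nats final rank_tau (nats final out_beta j)).
Proof.
rewrite -(@final_mx 9) //; apply: (fill_run (after_size 8)).
move=> s i j frn fre _ si sj; rewrite [RHS]mxE [LHS]/= si sj !frn // fre //.
by rewrite !(@final_nats 8) // (@final_elts 8).
Qed.

Lemma final_B : mx m final out_B = \matrix_(i, j)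
  elts final out_S (nats final rank_sigma (nats final out_tau i))
                   (nats final rank_sigma (nats final out_gamma j)).
Proof.
rewrite -(@final_mx 10) //; apply: (fill_run (after_size 9)).
move=> s i j frn fre _ si sj; rewrite [RHS]mxE [LHS]/= si sj !frn // fre //.
by rewrite !(@final_nats 9) // (@final_elts 9).
Qed.

Lemma final_solution : mx m final out_T *m mx m final solution = mx m final out_B.
Proof.
rewrite -(@final_mx 10 out_T) // -(@final_mx 10 out_B) // -(@final_mx 11) //.
apply: (back_substitution_run (after_size 10)).
by rewrite final_mx //; case: final_umatch.
Qed.

Lemma final_umatch' : umatch (mx m final out_T') (mx m final out_M')
  (\matrix_(i, j)
     elts final solution (nats final rank_tau (nats final out_beta i)) j)
  (mx m final out_S').
Proof.
rewrite -(@final_mx 12 out_T') // -(@final_mx 12 out_M') //.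
rewrite -(@final_mx 12 out_S') //.
apply: (umatch_into_run (after_size 11)) => //.
apply: (fill_run (after_size 11)).
move=> s i j frn fre _ si sj; rewrite [RHS]mxE [LHS]/= si sj !frn // fre //.
by rewrite !(@final_nats 11) // (@final_elts 11).
Qed.

Lemma final_product : mx m final product = mx m final out_A *m mx m final out_T'.
Proof.
rewrite -(@final_mx 13) // -(@final_mx 12 out_A) // -(@final_mx 12 out_T') //.
exact: (representatives_run (after_size 12)).
Qed.

Lemma final_output :
  let ker j := nats final ker_keys (nats final out_gamma j) in
  let im i := nats final im_keys (nats final out_beta i) in
  exists L : seq ('I_m * 'I_m),
    [/\ uniq L,
        forall x, (x \in L) =
          (elts final out_M' x.1 x.2 != 0) && (ker x.2 != im x.1),
        nats final out_size 0 = size L &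
        forall k x0, (k < size L)%N ->
          [/\ nats final out_ker k = ker (nth x0 L k).2,
              nats final out_im k = im (nth x0 L k).1 &
              forall i : 'I_m, elts final out_chain k i =
                elts final product (nats final rank_tau i) (nth x0 L k).1]].
Proof.
move=> ker im; have [L [uL memL sL nthL]] := write_output_run (after_size 13).
have kerE j : nats (after 13) ker_keys (nats (after 13) out_gamma j) = ker j.
  by rewrite !(@final_nats 13).
have imE i : nats (after 13) im_keys (nats (after 13) out_beta i) = im i.
  by rewrite !(@final_nats 13).
exists L; split=> [//|x|//|k x0 kL].
  by rewrite memL kerE imE (@final_elts 13).
have [nk ni nc] := nthL k x0 kL; split.
- by rewrite -kerE.
- by rewrite -imE.
- by move=> i; rewrite -(@final_nats 13) // -(@final_elts 13 product) //; apply: nc.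
Qed.

End Stages.

Section Trace.
Variables (K : fieldType) (X : cell_complex K) (N m : nat).
Variables (F G : filtration X N) (e : listing X m).
Hypothesis N1 : (1 <= N)%N.
Local Notation chain := {ffun X -> K^o}.

Lemma input_birthF (i : 'I_m) : nats (input F G e) in_birthF i = birth F (e i).
Proof. by rewrite /= valK. Qed.

Lemma input_birthG (i : 'I_m) : nats (input F G e) in_birthG i = birth G (e i).
Proof. by rewrite /= valK. Qed.

Lemma input_boundary (i j : 'I_m) :
  elts (input F G e) in_boundary i j = inc (e j) (e i).
Proof. by rewrite /= !valK. Qed.

Lemma lookup_ker_leq_all (r : trace X m) x t :
  (lookup_ker F G r x <= t)%N = (birth F x <= t)%N &&
    [forall i, (matM r i (rank (sigma r) x) != 0) ==>
               (birth G (tau r i) <= t)%N].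
Proof.
rewrite /lookup_ker geq_max andbC; have [xt|//] := boolP (birth F x <= t)%N.
have t1 : (1 <= t)%N by case/andP: (birth_range N1 F x) => b1 _; apply: leq_trans xt.
rewrite /chain_birth leq_bigmaxP t1 /=; apply/allP/forallP => H y.
  have := H (tau r y); rewrite mem_index_enum /col_M /col_chain sum_cell_chain itemK.
  by apply.
move=> _; have := H (rank (tau r) y).
by rewrite rankK /col_M /col_chain sum_cell_chain.
Qed.

Lemma lookup_im_geq_all (r : trace X m) x t : matching (matM r) ->
  (t <= lookup_im F G r x)%N = (t <= birth G x)%N &&
    [forall j, (matM r (rank (tau r) x) j != 0) ==>
               (t <= birth F (sigma r j))%N].
Proof.
move=> [Mrow _]; rewrite /lookup_im; case: pickP => [y My|M0].
  rewrite leq_min; congr (_ && _); apply/idP/'forall_implyP => [ty j Mj|].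
    by rewrite (Mrow _ _ _ Mj My) rankK.
  by move/(_ _ My); rewrite rankK.
suff -> : [forall j, (matM r (rank (tau r) x) j != 0) ==>
               (t <= birth F (sigma r j))%N] by rewrite andbT.
by apply/'forall_implyP => j; have := M0 (sigma r j); rewrite itemK => ->.
Qed.

Theorem algorithm_run :
  exists r : trace X m,
    is_run F G r /\ stores e (run algorithm (input F G e)) r.
Proof.
rewrite /algorithm run_foldr; set s0 := input F G e.
have s0m : nats s0 in_size 0 = m by [].
rewrite -/(final s0).
have [pS [sigE rkSE sigS]] := final_sigma s0m.
have [pT [tauE rkTE tauS]] := final_tau s0m.
have [pB [betaE betaS]] := final_beta s0m.
have [pG [gammaE gammaS]] := final_gamma s0m.
have DE := final_D s0m.
have uTMDS := final_umatch s0m.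
have AE := final_A s0m.
have BE := final_B s0m.
have YE := final_solution s0m.
have uTMDS' := final_umatch' s0m.
have prodE := final_product s0m.
have kerE := final_ker_keys s0m.
have imE := final_im_keys s0m.
have [L [uL memL sL nthL]] := final_output s0m.
have bF (i : 'I_m) : nats (final s0) in_birthF i = birth F (e i).
  by rewrite -(@final_nats _ _ 0) //; apply: input_birthF.
have bG (i : 'I_m) : nats (final s0) in_birthG i = birth G (e i).
  by rewrite -(@final_nats _ _ 0) //; apply: input_birthG.
have bd (i j : 'I_m) : elts (final s0) in_boundary i j = inc (e j) (e i).
  by rewrite -(@final_elts _ _ 0) //; apply: input_boundary.
set f := final s0; rewrite -/f in sigE rkSE tauE rkTE betaE betaS gammaE gammaS
  sigS tauS DE uTMDS AE BE YE uTMDS' prodE kerE imE memL sL nthL bF bG bd.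
clearbody f.
(* The output of a trace is defined from its other fields, hence two steps. *)
pose r0 := Trace (relist e pS) (relist e pT) (mx m f out_D) (mx m f out_T)
  (mx m f out_M) (mx m f out_S) (relist e pB) (relist e pG) (mx m f out_A)
  (mx m f out_B) (mx m f out_T') (mx m f out_M') (mx m f out_S') [::].
pose bar (x : 'I_m * 'I_m) := (lookup_ker F G r0 (gamma r0 x.2),
  lookup_im F G r0 (beta r0 x.1), representative r0 x.1).
pose r := Trace (relist e pS) (relist e pT) (mx m f out_D) (mx m f out_T)
  (mx m f out_M) (mx m f out_S) (relist e pB) (relist e pG) (mx m f out_A)
  (mx m f out_B) (mx m f out_T') (mx m f out_M') (mx m f out_S') (map bar L).
have [_ uT uS mM] := uTMDS.
have kerV (i : 'I_m) : nats f ker_keys i = lookup_ker F G r (e i).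
  apply: eq_from_leq => t; rewrite kerE lookup_ker_leq_all bF.
  congr (_ && _); apply: eq_forallb => j.
  by rewrite rkSE tauE bG /= mxE itemK.
have imV (i : 'I_m) : nats f im_keys i = lookup_im F G r (e i).
  apply: eq_from_geq => t; rewrite imE lookup_im_geq_all // bG.
  congr (_ && _); apply: eq_forallb => j.
  by rewrite rkTE sigE bF /= mxE itemK.
have AT i j : matA r i j = matT r i (pT ((pB^-1)%g j)).
  by rewrite /= AE [LHS]mxE betaE rkTE !mxE.
have uA : matA r \in unitmx.
  apply: (perm_cols_unit (f := id) (g := fun j => pT ((pB^-1)%g j))) AT _ => //.
    by move=> i j /perm_inj/perm_inj.
  exact: unitriangular_unit.
(* A is T with its columns permuted, so that A^-1 B is T^-1 B with its rows
   permuted. *)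
have AW : invmx (matA r) *m matB r =
    \matrix_(i, j) elts f solution (nats f rank_tau (nats f out_beta i)) j.
  rewrite -[RHS](mulKmx uA); congr (_ *m _); rewrite -[LHS]YE.
  apply/matrixP => i c; rewrite !mxE.
  rewrite (reindex (fun j => pT ((pB^-1)%g j))) /=; last first.
    apply: onW_bij; exists (fun k => pB ((pT^-1)%g k)) => k.
      by rewrite permK permKV.
    by rewrite permK permKV.
  apply: eq_bigr => j _; rewrite -/(matT r) -AT [X in _ = _ * X]mxE betaE rkTE.
  by congr (_ * _); rewrite mxE.
have run_r : is_run F G r.
  split=> //.
  - by move=> i j /sigS; rewrite !bF.
  - by move=> i j /tauS; rewrite !bG.
  - move=> j; apply/ffunP => y; rewrite boundary_cell sum_item_chain /= DE mxE.
    by rewrite sigE tauE bd permK rankK.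
  - by move=> i j /betaS; rewrite !imV.
  - by move=> i j /gammaS; rewrite !kerV.
  - by move=> i j; rewrite AT /= !itemK permKV.
  - move=> i j; rewrite /= BE [LHS]mxE tauE gammaE !rkSE !itemK.
    by rewrite mxE.
  - by rewrite AW.
  - rewrite map_inj_in_uniq // => -[i j] [i' j']; rewrite !memL /=.
    move=> /andP[Mij _] /andP[Mij' _].
    case=> _ _ /(@representative_inj _ _ _ r0) eij.
    have {eij} eij : i = i'.
      by apply: eij; rewrite unitmx_mul uA; case: uTMDS' => _ /unitriangular_unit.
    case: uTMDS' => _ _ _ [Mrow _]; rewrite -eij in Mij' *.
    by rewrite (Mrow i j j') // mxE.
  - move=> x; split=> [/mapP[[i j]]|[i [j [Mij ne ->]]]].
      rewrite memL => /andP[Mij ne] ->; exists i, j; split=> //=.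
        by rewrite mxE.
      by move: ne; rewrite /= gammaE betaE kerV imV.
    apply/mapP; exists (i, j) => //; rewrite memL /= gammaE betaE kerV imV ne andbT.
    by move: Mij; rewrite mxE.
have stores_mx x : stores_matrix f x (mx m f x) by move=> i j; rewrite mxE.
exists r; split=> //; split=> //=.
- by move=> i; rewrite sigE /= itemK.
- by move=> i; rewrite tauE /= itemK.
- by move=> i; rewrite betaE /= itemK.
- by move=> i; rewrite gammaE /= itemK.
split=> [|k]; rewrite size_map // => kL.
have x0 : 'I_m * 'I_m by case: (L) kL.
rewrite (nth_map x0) //; have [nk ni nc] := nthL k x0 kL.
split=> [||i]; first by rewrite nk gammaE kerV.
  by rewrite ni betaE imV.
rewrite nc rkTE sum_item_chain /= itemK -prodE mxE //.
Qed.

Lemma algorithm_cost : (1 <= m)%N ->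
  ((exec algorithm (input F G e)).2 <= weight algorithm * m ^ 3)%N.
Proof.
move=> m1; apply: leq_trans (@exec_cost _ algorithm (input F G e) _ m1 erefl isT) _.
by rewrite leq_mul2l leq_pexp2l ?orbT.
Qed.

End Trace.

Theorem mainTheorem2 :
  (forall (K : fieldType) (X : cell_complex K) (N m : nat)
      (F G : filtration X N),
    (1 <= N)%N -> #|X| = m ->
    (forall k, (1 <= k <= N)%N -> G k \subset F k) ->
    forall r : trace X m, is_run F G r -> correct F G r) /\
  (exists (p : program) (C : nat),
    forall (K : fieldType) (X : cell_complex K) (N m : nat)
      (F G : filtration X N) (e : listing X m),
    (1 <= N)%N -> #|X| = m ->
    (forall k, (1 <= k <= N)%N -> G k \subset F k) ->
    exists r : trace X m,
      [/\ is_run F G r,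
          stores e (exec p (input F G e)).1 r &
          (1 <= m)%N -> ((exec p (input F G e)).2 <= C * m ^ 3)%N]).
Proof.
split=> [K X N m F G N1 _ GF r run_r|]; first exact: run_correct.
exists algorithm, (weight algorithm) => K X N m F G e N1 _ _.
have [r [run_r store_r]] := algorithm_run F G e N1.
by exists r; split=> // m1; apply: algorithm_cost.
Qed.
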